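(* Let $d\ge1$ and let $\Pi$ be any translation-invariant ergodic simple point process of unit intensity on $\mathbb{R}^d$, with law $\Lambda$. Then there exists a balanced (continuum) allocation rule for $\Pi$.
   Context: Elements of $\mathbb{R}^d$ are called sites; integer-valued (locally finite) Borel measures on $\mathbb{R}^d$ are called configurations. A point process is a random configuration; it is simple if almost surely every atom has mass $1$. For $z\in\mathbb{R}^d$, $T^zx=x+z$ for sites $x$ and $(T^z\pi)(\cdot)=\pi(\cdot-z)$ for configurations $\pi$. Translation-invariance and ergodicity are with respect to all $T^z$. The support of $\Pi$ is $[\Pi]=\{x\in\mathbb{R}^d:\Pi(\{x\})=1\}$, and $\mathcal{L}$ is Lebesgue measure. A (continuum) allocation rule for $\Pi$ is a measurable function $\Psi$ which assigns to $\Lambda$-almost-every configuration $\pi$ and every site $x$ a site $\Psi_\pi(x)$, and which is translation-invariant: if $\Psi_\pi(x)=y$, then $\Psi_{T^z\pi}(T^zx)=T^zy$ (for all configurations $\pi$, so in particular $\Psi_{T^z\pi}$ is defined if and only if $\Psi_\pi$ is). It is balanced if $\Lambda$-almost-surely $\mathcal{L}(\Psi_\Pi^{-1}(s))=1$ for each $s\in[\Pi]$, and $\mathcal{L}(\Psi_\Pi^{-1}(\mathbb{R}^d\setminus[\Pi]))=0$. *)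

(* Defs.v *)
From HB Require Import structures.
From mathcomp Require Import all_boot all_order all_algebra.
From mathcomp Require Import all_classical all_reals all_analysis.
From mathcomp Require Import measurable_realfun.

Set Implicit Arguments.
Unset Strict Implicit.
Unset Printing Implicit Defensive.
Import Order.TTheory GRing.Theory Num.Theory.
Import numFieldNormedType.Exports.

Local Open Scope classical_set_scope.
Local Open Scope ring_scope.

Definition borel_rV_display : measure_display.
Proof. by constructor. Qed.

Section borel_rV.
Variables (R : realType) (n : nat).

Definition borel_rV : set_system 'rV[R]_n := <<s @open 'rV[R]_n >>.

Let borel_rV0 : borel_rV set0.
Proof. exact: sigma_algebra0. Qed.

Let borel_rVC (A : set 'rV[R]_n) : borel_rV A -> borel_rV (~` A).
Proof. exact: sigma_algebraC. Qed.

Let borel_rVU (F : (set 'rV[R]_n)^nat) :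
  (forall i, borel_rV (F i)) -> borel_rV (\bigcup_i F i).
Proof. exact: sigma_algebra_bigcup. Qed.

HB.instance Definition _ := @isMeasurable.Build borel_rV_display
  'rV[R]_n borel_rV borel_rV0 borel_rVC borel_rVU.

Lemma open_measurable_rV (U : set 'rV[R]_n) : open U -> measurable U.
Proof. exact: sub_sigma_algebra. Qed.

Lemma measurable_shift_rV (z : 'rV[R]_n) :
  measurable_fun [set: 'rV[R]_n] (fun x : 'rV[R]_n => x + z).
Proof.
apply: (@measurability _ _ _ _ _ _ (@open 'rV[R]_n)) => //.
move=> _ [U oU <-]; rewrite setTI; apply: open_measurable_rV.
by apply: open_comp => // x _; apply: continuousD; [exact: cvg_id|exact: cst_continuous].
Qed.

End borel_rV.

Section borel_rV_coordinates.
Variable R : realType.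

Lemma measurable_coord_rV n i : measurable_fun [set: 'rV[R]_n]
  (fun v : 'rV[R]_n => v ord0 i : measurableTypeR R).
Proof.
apply: (@measurability _ _ _ _ _ _ (@RGenOpens.G R)).
  exact: RGenOpens.measurableE.
move=> _ [_ [a [b ->]] <-]; rewrite setTI; apply: open_measurable_rV.
by apply: open_comp => [? _|]; [exact: coord_continuous|exact: interval_open].
Qed.

Lemma measurable_fun_rVP d (T : measurableType d) n (f : T -> 'rV[R]_n) :
  (forall i, measurable_fun [set: T] (fun t => f t ord0 i : measurableTypeR R)) ->
  measurable_fun [set: T] f.
Proof.
move=> mf; apply: (@measurability _ _ _ _ _ _ (@open 'rV[R]_n)) => //.
move=> _ [U oU <-]; rewrite setTI.
pose c (p : 'rV[rat]_n * nat) : 'rV[R]_n := \row_i ratr (p.1 ord0 i).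
pose B (p : 'rV[rat]_n * nat) : set 'rV[R]_n := ball (c p) p.2.+1%:R^-1.
have -> : U = \bigcup_p (if `[< B p `<=` U >] then B p else set0).
  apply/seteqP; split => x; last first.
    by case=> p _; case: ifPn => // /asboolP BU; exact: BU.
  move=> Ux.
  have /nbhs_ballP[e /= e0 xeU] : nbhs x U by exact: open_nbhs_nbhs.
  have [k ke] : exists k : nat, (k.+1%:R^-1 < e / 2 :> R)%R.
    have e2 : (0 < e / 2 :> R)%R by rewrite divr_gt0.
    by have [k _ /(_ _ (leqnn k)) ke] := near_infty_natSinv_lt (PosNum e2); exists k.
  have kx i : exists q : rat, ball (x ord0 i) (k.+1%:R^-1 : R) (ratr q).
    have /rat_in_itvoo[q] : (x ord0 i - k.+1%:R^-1 < x ord0 i + k.+1%:R^-1 :> R)%R.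
      by rewrite ltrD2l gt0_cp// invr_gt0.
    by exists q; rewrite ball_itv.
  have [g gx] := choice kx.
  pose p := (\row_i g i, k) : 'rV[rat]_n * nat.
  have Bpx : B p x.
    by split => [|i j]; rewrite ?invr_gt0//= !mxE (ord1 i); apply: ball_sym.
  exists p => //; rewrite ifT//; apply/asboolP => y Bpy; apply: xeU.
  apply: (@le_ball _ _ _ (k.+1%:R^-1 + k.+1%:R^-1)).
    by rewrite [leRHS]splitr lerD// ltW.
  by apply: ball_triangle Bpy; exact: ball_sym.
rewrite preimage_bigcup; apply: countable_bigcupT_measurable => // p.
case: asboolP => _; last by rewrite preimage_set0.
have -> : f @^-1` B p = \bigcap_i (fun t => f t ord0 i) @^-1` ball (c p ord0 i) p.2.+1%:R^-1.
  apply/seteqP; split => [t [_ h] i _|t h]; first exact: h.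
  by split => [|i j]; [rewrite invr_gt0|rewrite (ord1 i); exact: h].
apply: fin_bigcap_measurable => // i _.
rewrite -[X in measurable X]setTI; apply: mf => //.
exact: measurable_ball.
Qed.

Definition cons_rV n (p : measurableTypeR R * 'rV[R]_n) : 'rV[R]_n.+1 :=
  row_mx ((p.1 : R)%:M : 'rV[R]_1) p.2.

Definition uncons_rV n (v : 'rV[R]_n.+1) : measurableTypeR R * 'rV[R]_n :=
  (v ord0 ord0, \row_i v ord0 (lift ord0 i)).

Lemma cons_rVK n : cancel (@cons_rV n) (@uncons_rV n).
Proof.
case=> x y; rewrite /cons_rV /uncons_rV/=; congr pair.
  have -> : (ord0 : 'I_n.+1) = lshift n (ord0 : 'I_1) by exact/val_inj.
  by rewrite (row_mxEl (x%:M : 'rV[R]_1) y) mxE eqxx.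
apply/rowP => i; rewrite mxE -(rshift1 i).
by rewrite (row_mxEr (x%:M : 'rV[R]_1) y).
Qed.

Lemma uncons_rVK n : cancel (@uncons_rV n) (@cons_rV n).
Proof.
move=> v; apply/rowP => i; rewrite /cons_rV /uncons_rV/=.
have [j ->|j ->] := @split_ordP 1 n i.
  rewrite (row_mxEl ((v ord0 ord0)%:M : 'rV[R]_1)) mxE !ord1 eqxx; congr (v _ _); exact/val_inj.
by rewrite (row_mxEr ((v ord0 ord0)%:M : 'rV[R]_1)) mxE rshift1.
Qed.

Lemma measurable_cons_rV n : measurable_fun setT (@cons_rV n).
Proof.
apply: measurable_fun_rVP => i; rewrite /cons_rV.
have [j ->|j ->] := @split_ordP 1 n i.
  rewrite (_ : (fun t => _) = fst); first exact: measurable_fst.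
  by apply/funext => t; rewrite (row_mxEl ((t.1 : R)%:M : 'rV[R]_1)) mxE !ord1 eqxx.
rewrite (_ : (fun t => _) = (fun v : 'rV[R]_n => v ord0 j) \o snd); last first.
  by apply/funext => t; rewrite (row_mxEr ((t.1 : R)%:M : 'rV[R]_1)).
apply: (measurableT_comp (@measurable_coord_rV n j)); exact: measurable_snd.
Qed.

Lemma measurable_uncons_rV n : measurable_fun setT (@uncons_rV n).
Proof.
apply: measurable_fun_pair; first exact: measurable_coord_rV.
apply: measurable_fun_rVP => i; under eq_fun do rewrite mxE.
exact: measurable_coord_rV.
Qed.

End borel_rV_coordinates.

Section lebesgue.
Variable R : realType.
Local Open Scope ereal_scope.

(* Lebesgue measure on R^n as the n-fold product of Lebesgue measure on R: by
   Fubini, the measure of A is the integral over the first coordinate x of the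
   measure of the section of A at x. *)
Fixpoint lebesgue_rV (n : nat) : set 'rV[R]_n -> \bar R :=
  match n return set 'rV[R]_n -> \bar R with
  | 0 => fun A => \d_(0%R : 'rV[R]_0) A
  | m.+1 => fun A => \int[lebesgue_measure]_x
      lebesgue_rV [set y : 'rV[R]_m | A (row_mx (x%:M : 'rV[R]_1) y)]
  end.

Section sigma_finite_pack.
Context d (T : measurableType d) (m : set T -> \bar R).
Hypotheses (m0 : m set0 = 0) (m_ge0 : forall A, 0 <= m A)
  (m_sigma_additive : semi_sigma_additive m) (m_sigma_finite : sigma_finite setT m).
Let m' := m.
HB.instance Definition _ := isMeasure.Build _ _ _ m' m0 m_ge0 m_sigma_additive.
HB.instance Definition _ := Measure_isSigmaFinite.Build _ _ _ m' m_sigma_finite.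
Definition sigma_finite_pack : {sigma_finite_measure set T -> \bar R} := m'.
End sigma_finite_pack.

Lemma product_sigma_finite d1 d2 (T1 : measurableType d1)
  (T2 : measurableType d2) (m1 : {sigma_finite_measure set T1 -> \bar R})
  (m2 : {sigma_finite_measure set T2 -> \bar R}) : sigma_finite setT (m1 \x m2).
Proof.
have /sigma_finiteP[F [TF ndF Foo]] := sigma_finiteT m1.
have /sigma_finiteP[G [TG ndG Goo]] := sigma_finiteT m2.
exists (fun n => F n `*` G n).
  rewrite -setXTT TF TG predeqE => -[x y]; split.
    move=> [/= [n _ Fnx] [k _ Gky]]; exists (maxn n k) => //; split.
    - by move: x Fnx; exact/subsetPset/ndF/leq_maxl.
    - by move: y Gky; exact/subsetPset/ndG/leq_maxr.
  by move=> [n _ []/= ? ?]; split; exists n.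
move=> k; have [? ?] := Foo k; have [? ?] := Goo k.
split; first exact: measurableX.
by rewrite product_measure1E// lte_mul_pinfty// ge0_fin_numE.
Qed.

Let lebesgue_rV_ind n :
  [/\ lebesgue_rV (set0 : set 'rV[R]_n) = 0,
   (forall A : set 'rV[R]_n, 0 <= lebesgue_rV A),
   semi_sigma_additive (@lebesgue_rV n) &
   sigma_finite setT (@lebesgue_rV n)].
Proof.
elim: n => [|n [h0 h1 h2 h3]].
  split=> //=; [exact: measure_semi_sigma_additive|].
  exact: (@sigma_finiteT _ _ _ (\d_(0%R : 'rV[R]_0))).
pose M := sigma_finite_pack h0 h1 h2 h3.
have E A : lebesgue_rV A = (lebesgue_measure \x M) (@cons_rV R n @^-1` A).
  rewrite /= /product_measure1; apply: eq_integral => x _ /=.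
  by congr (lebesgue_rV _); apply/seteqP; split => y /=;
    rewrite /xsection /= in_setE.
have mc A : measurable A -> measurable (@cons_rV R n @^-1` A).
  by move=> mA; rewrite -[X in measurable X]setTI; exact: measurable_cons_rV.
split.
- by rewrite E preimage_set0 measure0.
- by move=> A; rewrite E measure_ge0.
- move=> F mF tF mUF; rewrite E preimage_bigcup.
  under eq_fun do under eq_bigr do rewrite E.
  apply: measure_semi_sigma_additive.
  + by move=> i; exact: mc.
  + apply/trivIsetP => /= i j _ _ ij; rewrite -preimage_setI.
    by move/trivIsetP : tF => /(_ _ _ _ _ ij) ->//; rewrite preimage_set0.
  + by rewrite -preimage_bigcup; exact: mc.
- have [F FT Foo] := product_sigma_finite (@lebesgue_measure R) M.
  exists (fun k => @uncons_rV R n @^-1` F k).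
    by rewrite -preimage_bigcup -FT.
  move=> k; have [mF Fo] := Foo k; split.
    by rewrite -[X in measurable X]setTI; exact: measurable_uncons_rV.
  rewrite E -comp_preimage.
  have -> : (@uncons_rV R n \o @cons_rV R n) = id by apply/funext => x /=; rewrite cons_rVK.
  by [].
Qed.

Section lebesgue_rV_measure.
Variable n : nat.

Let lebesgue_rV0 : lebesgue_rV (set0 : set 'rV[R]_n) = 0.
Proof. by have [] := lebesgue_rV_ind n. Qed.

Let lebesgue_rV_ge0 (A : set 'rV[R]_n) : 0 <= lebesgue_rV A.
Proof. by have [] := lebesgue_rV_ind n. Qed.

Let lebesgue_rV_sigma_additive : semi_sigma_additive (@lebesgue_rV n).
Proof. by have [] := lebesgue_rV_ind n. Qed.

HB.instance Definition _ := isMeasure.Build _ _ _ (@lebesgue_rV n)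
  lebesgue_rV0 lebesgue_rV_ge0 lebesgue_rV_sigma_additive.

Let lebesgue_rV_sigma_finite : sigma_finite setT (@lebesgue_rV n).
Proof. by have [] := lebesgue_rV_ind n. Qed.

HB.instance Definition _ := Measure_isSigmaFinite.Build _ _ _ (@lebesgue_rV n)
  lebesgue_rV_sigma_finite.

End lebesgue_rV_measure.

End lebesgue.

Section configuration.
Variables (R : realType) (n : nat).
Local Open Scope ereal_scope.

(* The values of config_measure on non-Borel sets are unconstrained; nothing
   below depends on them. *)
Record configuration := Configuration {
  config_measure :> {measure set 'rV[R]_n -> \bar R};
  config_locally_finite : forall B : set 'rV[R]_n,
    measurable B -> bounded_set B -> config_measure B < +oo;
  config_integer_valued : forall B : set 'rV[R]_n,
    measurable B -> config_measure B < +oo ->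
    exists k : nat, config_measure B = k%:R%:E }.

HB.instance Definition _ := gen_eqMixin configuration.
HB.instance Definition _ := gen_choiceMixin configuration.

Let mzero_locally_finite (B : set 'rV[R]_n) :
  measurable B -> bounded_set B -> (mzero B : \bar R) < +oo.
Proof. by move=> _ _; rewrite ltry. Qed.

Let mzero_integer_valued (B : set 'rV[R]_n) : measurable B ->
  (mzero B : \bar R) < +oo -> exists k : nat, mzero B = k%:R%:E :> \bar R.
Proof. by exists 0%N. Qed.

HB.instance Definition _ := isPointed.Build configuration
  (Configuration mzero_locally_finite mzero_integer_valued).

Definition configuration_display : measure_display.
Proof. by constructor. Qed.

(* The usual sigma-algebra on configurations, generated by the evaluations
   pi |-> pi B for B Borel. *)
Definition configuration_measurable : set_system configuration :=
  <<s \bigcup_(B in @measurable _ 'rV[R]_n)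
        preimage_set_system [set: configuration]
          (fun pi : configuration => pi B) measurable >>.

Let configuration_measurable0 : configuration_measurable set0.
Proof. exact: sigma_algebra0. Qed.

Let configuration_measurableC (A : set configuration) :
  configuration_measurable A -> configuration_measurable (~` A).
Proof. exact: sigma_algebraC. Qed.

Let configuration_measurableU (F : (set configuration)^nat) :
  (forall i, configuration_measurable (F i)) ->
  configuration_measurable (\bigcup_i F i).
Proof. exact: sigma_algebra_bigcup. Qed.

HB.instance Definition _ := @isMeasurable.Build configuration_display
  configuration configuration_measurable configuration_measurable0
  configuration_measurableC configuration_measurableU.

Section translate.
Variables (z : 'rV[R]_n) (pi : configuration).

Definition translate_measure : set 'rV[R]_n -> \bar R :=
  pushforward pi (fun x : 'rV[R]_n => (x + z)%R).

Let mshift (B : set 'rV[R]_n) : measurable B ->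
  measurable ((fun x : 'rV[R]_n => (x + z)%R) @^-1` B).
Proof. by move=> mB; rewrite -[X in measurable X]setTI; exact: measurable_shift_rV. Qed.

Let translate_measure0 : translate_measure set0 = 0.
Proof. by rewrite /translate_measure /pushforward preimage_set0 measure0. Qed.

Let translate_measure_ge0 B : 0 <= translate_measure B.
Proof. exact: (measure_ge0 pi). Qed.

Let translate_measure_sigma_additive : semi_sigma_additive translate_measure.
Proof.
move=> F mF tF mUF; rewrite /translate_measure /pushforward preimage_bigcup.
apply: measure_semi_sigma_additive.
- by move=> i; exact: mshift.
- apply/trivIsetP => /= i j _ _ ij; rewrite -preimage_setI.
  by move/trivIsetP : tF => /(_ _ _ _ _ ij) ->//; rewrite preimage_set0.
- by rewrite -preimage_bigcup; exact: mshift.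
Qed.

HB.instance Definition _ := isMeasure.Build _ _ _ translate_measure
  translate_measure0 translate_measure_ge0 translate_measure_sigma_additive.

Let translate_locally_finite (B : set 'rV[R]_n) :
  measurable B -> bounded_set B -> translate_measure B < +oo.
Proof.
move=> mB [M [Mreal MB]]; apply: config_locally_finite; first exact: mshift.
exists (M + `|z|)%R; split; first by rewrite num_real.
move=> r Mr x /= Bx; have := MB (r - `|z|)%R.
rewrite ltrBrDr => /(_ Mr _ Bx) /= h.
rewrite -(addrK z x) (le_trans (ler_normB _ _))//.
by rewrite -lerBrDr.
Qed.

Let translate_integer_valued (B : set 'rV[R]_n) : measurable B ->
  translate_measure B < +oo -> exists k : nat, translate_measure B = k%:R%:E.
Proof. by move=> mB; apply: config_integer_valued; exact: mshift. Qed.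

(* (T^z pi) B = pi (B - z), as B - z = {x | x + z \in B} *)
Definition translate : configuration :=
  Configuration translate_locally_finite translate_integer_valued.

End translate.

Definition support (pi : configuration) : set 'rV[R]_n :=
  [set x | pi [set x] = 1].

End configuration.

Section point_process.
Variables (R : realType) (n : nat).
Local Open Scope ereal_scope.

(* Lam is the law of the point process. *)
Implicit Types Lam : probability (configuration R n) R.

Definition translation_invariant Lam :=
  forall (z : 'rV[R]_n) (A : set (configuration R n)), measurable A ->
  Lam (translate z @^-1` A) = Lam A.

Definition ergodic Lam :=
  forall A : set (configuration R n), measurable A ->
  (forall z, translate z @^-1` A = A) -> Lam A = 0 \/ Lam A = 1.

Definition simple_process Lam :=
  {ae Lam, forall pi : configuration R n, forall x : 'rV[R]_n,
    0 < pi [set x] -> pi [set x] = 1}.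

Definition unit_intensity Lam :=
  forall B : set 'rV[R]_n, measurable B ->
  \int[Lam]_pi (pi B) = lebesgue_rV B.

(* An allocation rule is a partial function of the configuration pi, defined
   (at every site) exactly when pi belongs to alloc_dom; the values of alloc_fun
   outside alloc_dom carry no information. *)
Record allocation_rule Lam := AllocationRule {
  alloc_dom : set (configuration R n);
  alloc_fun :> configuration R n -> 'rV[R]_n -> 'rV[R]_n;
  alloc_dom_measurable : measurable alloc_dom;
  alloc_dom_ae : {ae Lam, forall pi : configuration R n, alloc_dom pi};
  alloc_fun_measurable : measurable_fun (alloc_dom `*` [set: 'rV[R]_n])
    (fun p : configuration R n * 'rV[R]_n => alloc_fun p.1 p.2);
  alloc_dom_translate : forall z pi,
    alloc_dom (translate z pi) <-> alloc_dom pi;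
  alloc_fun_translate : forall z pi x y, alloc_dom pi ->
    alloc_fun pi x = y -> alloc_fun (translate z pi) (x + z)%R = (y + z)%R }.

Definition balanced Lam (Psi : allocation_rule Lam) :=
  {ae Lam, forall pi : configuration R n,
    (forall s, support pi s -> lebesgue_rV (Psi pi @^-1` [set s]) = 1) /\
    lebesgue_rV (Psi pi @^-1` (~` support pi)) = 0}.

End point_process.

(* Main.v *)
From HB Require Import structures.
From mathcomp Require Import all_boot all_order all_algebra.
From mathcomp Require Import all_classical all_reals all_analysis.
From mathcomp Require Import measurable_realfun lra.
Require Import Defs.

(** The allocation is built by a countable greedy matching of sites to atoms.
Enumerate the balls [D_0, D_1, ...] of [R^n] with rational centre and radius
[1 / (m + 1)]. In round [k], a still unmatched site [x] proposes to the atom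
[y] of mass one if [x - y] lies in [D_k] and [y] carries the whole mass of
[x - D_k]; an atom accepts all its proposals of the round if its total load
then stays at most one, and none of them otherwise ([proposal], [round],
[matching]). Only differences of sites enter, so the construction commutes with
translations, and everything is measurable because [pi (S_x)] is measurable in
[(pi, x)] for measurable [S] ([measurable_config_xsection]).

No configuration has both an unmatched site and an underloaded atom
([matching_exhaustive]): if [x] stays unmatched and the final load of [y] is
less than one, then for some small ball [D_k] around [x - y] the site [x]
proposes to [y] in round [k] and all the proposals fit, since their volume is
at most that of [D_k].

It remains to compare means. By the mass transport principle ([mass_transport],
from translation invariance of the law, with unit cells of the integer
lattice), the mean volume of matched sites in a unit cell equals the mean total
load of the atoms in it. By unit intensity, the first is one if and only if
almost every site is matched, and the second is one if and only if every atom
has load one. The event that the unmatched sites have positive volume is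
invariant, so it has probability zero or one by ergodicity. If it had
probability one, all atoms would have load one by [matching_exhaustive], hence
almost all sites would be matched: so almost surely almost all sites are
matched, and then all the atoms have load one. *)

Set Implicit Arguments.
Unset Strict Implicit.
Unset Printing Implicit Defensive.
Import Order.TTheory GRing.Theory Num.Theory.
Import numFieldNormedType.Exports.

Local Open Scope classical_set_scope.
Local Open Scope ring_scope.
Local Open Scope ereal_scope.

(** * Preliminaries in measure theory *)

Lemma measurable_preimage d d' (T : measurableType d) (T' : measurableType d')
  (f : T -> T') (A : set T') :
  measurable_fun setT f -> measurable A -> measurable (f @^-1` A).
Proof. by move=> mf mA; rewrite -[X in measurable X]setTI; exact: mf. Qed.

Lemma xsectionE d d' (X : measurableType d) (Y : measurableType d')
  (A : set (X * Y)) x : xsection A x = [set y | A (x, y)].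
Proof. by apply/seteqP; split=> y; rewrite /xsection/= in_setE. Qed.

(** Two comparable functions with the same finite integral agree almost
everywhere. *)
Lemma ae_eq_le_integral d (T : measurableType d) (R : realType)
    (mu : {measure set T -> \bar R}) (D : set T) (f g : T -> \bar R) :
  measurable D -> measurable_fun D f -> measurable_fun D g ->
  (forall x, D x -> 0 <= f x) -> (forall x, D x -> f x <= g x) ->
  (forall x, D x -> g x < +oo) -> \int[mu]_(x in D) g x < +oo ->
  \int[mu]_(x in D) g x <= \int[mu]_(x in D) f x ->
  ae_eq mu D f g.
Proof.
move=> mD mf mg f0 fg goo igoo gf.
have ffin x : D x -> f x \is a fin_num.
  by move=> Dx; rewrite ge0_fin_numE ?f0//; apply: le_lt_trans (goo _ Dx);
    exact: fg.
have h0 x : D x -> 0 <= g x - f x.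
  by move=> Dx; rewrite sube_ge0 ?ffin//; exact: fg.
have mh : measurable_fun D (fun x => g x - f x) by exact: emeasurable_funB.
have gE : \int[mu]_(x in D) g x =
    \int[mu]_(x in D) f x + \int[mu]_(x in D) (g x - f x).
  rewrite -ge0_integralD//; apply: eq_integral => x; rewrite inE => Dx.
  by rewrite addeC subeK// ffin.
have iffin : \int[mu]_(x in D) f x \is a fin_num.
  rewrite ge0_fin_numE ?integral_ge0//; apply: le_lt_trans igoo.
  exact: ge0_le_integral.
have ih0 : \int[mu]_(x in D) (g x - f x) = 0.
  apply/eqP; rewrite eq_le integral_ge0// andbT.
  move: gf; rewrite gE -[leRHS]adde0 leeD2lE//.
have : ae_eq mu D (fun x => g x - f x) (cst 0).
  apply/ae_eq_integral_abs => //; rewrite -[RHS]ih0; apply: eq_integral => x.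
  by rewrite inE => Dx; rewrite gee0_abs// h0.
apply: filterS => x h Dx; have /= gf0 := h Dx.
by rewrite -[RHS](@subeK _ _ (f x)) ?ffin// gf0 add0e.
Qed.

(** * Lebesgue measure on R^n: translations, cubes and small balls *)

Section lebesgue_rV_theory.
Variable R : realType.

(** Translation by [a], as a measurable function on the line. *)
Definition shiftR (a : R) : measurableTypeR R -> measurableTypeR R :=
  fun x : R => (x + a)%R.

Let measurable_shiftR a : measurable_fun setT (shiftR a).
Proof. exact: measurable_funD. Qed.

HB.instance Definition _ a :=
  isMeasurableFun.Build _ _ _ _ (shiftR a) (measurable_shiftR a).

Lemma lebesgue_measure_shift (a : R) (A : set R) : measurable A ->
  pushforward lebesgue_measure (shiftR a) A = lebesgue_measure A.
Proof.
move=> mA; apply/esym/lebesgue_measure_unique => //= _ [[b c]] _ <-.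
rewrite /pushforward.
have -> : shiftR a @^-1` `]b, c] = `](b - a)%R, (c - a)%R]%classic.
  by apply/seteqP; split=> x; rewrite /shiftR /= !in_itv/= ltrBlDr lerBrDr.
rewrite !lebesgue_measure_itv/= !lte_fin ltrD2r.
by case: ifP => // _; rewrite -!EFinB opprB addrA subrK.
Qed.

Lemma ge0_integral_lebesgue_shift (a : R) (f : R -> \bar R) :
  measurable_fun [set: R] f -> (forall x, 0 <= f x) ->
  \int[lebesgue_measure]_x f (x + a)%R = \int[lebesgue_measure]_x f x.
Proof.
move=> mf f0.
transitivity (\int[pushforward lebesgue_measure (shiftR a)]_x f x).
  by rewrite ge0_integral_pushforward.
by apply: eq_measure_integral => A mA _; exact: lebesgue_measure_shift.
Qed.

Lemma lebesgue_rVS n (A : set 'rV[R]_n.+1) :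
  lebesgue_rV A =
  \int[lebesgue_measure]_x lebesgue_rV (xsection (@cons_rV R n @^-1` A) x).
Proof.
apply: eq_integral => x _; congr lebesgue_rV.
by apply/seteqP; split=> y; rewrite /xsection/= in_setE.
Qed.

Lemma measurable_lebesgue_section n (A : set 'rV[R]_n.+1) : measurable A ->
  measurable_fun [set: measurableTypeR R]
    (fun x => lebesgue_rV (xsection (@cons_rV R n @^-1` A) x)).
Proof.
by move=> mA; apply: measurable_fun_xsection; apply: measurable_preimage => //;
  exact: measurable_cons_rV.
Qed.

Lemma lebesgue_rV_shift n (z : 'rV[R]_n) (A : set 'rV[R]_n) : measurable A ->
  lebesgue_rV ((fun x => (x + z)%R) @^-1` A) = lebesgue_rV A.
Proof.
elim: n z A => [|n IH] z A mA.
  congr lebesgue_rV; apply/seteqP; split=> x /=;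
  by rewrite (_ : (x + z)%R = x)//; apply/rowP => -[].
rewrite [RHS]lebesgue_rVS -(ge0_integral_lebesgue_shift (uncons_rV z).1)//;
  last first.
  exact: measurable_lebesgue_section.
rewrite lebesgue_rVS; apply: eq_integral => x _.
rewrite -[RHS](IH (uncons_rV z).2); last first.
  apply: measurable_xsection; apply: measurable_preimage => //.
  exact: measurable_cons_rV.
have cD (y : 'rV[R]_n) :
    (cons_rV (x, y) + z = cons_rV ((x + (uncons_rV z).1), y + (uncons_rV z).2))%R.
  rewrite -{1}(uncons_rVK z) /cons_rV; move: (uncons_rV z) => [z1 z2] /=.
  by rewrite (add_row_mx ((x : R)%:M : 'rV[R]_1) y) raddfD.
by congr lebesgue_rV; apply/seteqP; split=> y; rewrite /xsection/= !in_setE/= cD.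
Qed.

(** The half-open cube with all coordinates between [a] and [b]. *)
Definition cube n (a b : R) : set 'rV[R]_n := [set x | forall i, x ord0 i \in `[a, b[].

Lemma measurable_cube n a b : measurable (@cube n a b).
Proof.
rewrite (_ : cube _ _ = \bigcap_i (fun x : 'rV[R]_n => x ord0 i) @^-1` `[a, b[).
  apply: fin_bigcap_measurable => // i _; apply: measurable_preimage => //.
  exact: measurable_coord_rV.
by apply/seteqP; split=> x h i; [move=> _|]; exact: h.
Qed.

Lemma lebesgue_cube n (a b : R) : (a <= b)%R ->
  lebesgue_rV (@cube n a b) = ((b - a) ^+ n)%:E.
Proof.
move=> ab; elim: n => [|n IH].
  by rewrite /= diracE expr0 mem_set// => -[].
rewrite lebesgue_rVS.
have sE (x : R) : xsection (@cons_rV R n @^-1` cube a b) x =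
    if x \in `[a, b[ then cube a b else set0.
  apply/seteqP; split=> y; rewrite /xsection/= in_setE /cube/=.
    move=> h; case: ifPn => [_ i|/negP].
      by move: (h (lift ord0 i));
        rewrite /cons_rV -(rshift1 i) (row_mxEr ((x : R)%:M : 'rV[R]_1) y).
    case; move: (h (lshift n (ord0 : 'I_1))).
    by rewrite /cons_rV (row_mxEl ((x : R)%:M : 'rV[R]_1) y) mxE eqxx.
  case: ifPn => // xab h i; rewrite /cons_rV.
  have [j ->|j ->] := @split_ordP 1 n i;
    last by rewrite (row_mxEr ((x : R)%:M : 'rV[R]_1) y).
  by rewrite (row_mxEl ((x : R)%:M : 'rV[R]_1) y) mxE !ord1 eqxx.
transitivity (\int[lebesgue_measure]_x
    (((b - a) ^+ n)%:E * (\1_(`[a, b[%classic) x)%:E)).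
  apply: eq_integral => x _; rewrite sE indicE mem_setE.
  by case: ifP => xab; rewrite ?mule1 ?mule0 ?measure0// -IH.
rewrite ge0_integralZl//.
- rewrite integral_indic// setIT -[X in _ * X]/(lebesgue_measure `[a, b[%classic).
  rewrite lebesgue_measure_itv/= exprSr EFinM.
  rewrite lte_fin; case: ltP => // ba; rewrite (_ : b = a) ?subrr ?mule0//.
  by apply/eqP; rewrite eq_le ab ba.
- exact/measurable_EFinP.
- by rewrite lee_fin exprn_ge0// subr_ge0.
Qed.

Lemma measurable_ball_rV n (c : 'rV[R]_n) r : measurable (ball c r).
Proof. by apply: open_measurable_rV; exact: ball_open. Qed.

Lemma lebesgue_ball_le n (c : 'rV[R]_n) r : (1 <= n)%N -> (0 < r)%R ->
  (r + r <= 1)%R -> lebesgue_rV (ball c r) <= (r + r)%:E.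
Proof.
move=> n1 r0 r1.
have mC : measurable ((fun x => (x - c)%R) @^-1` @cube n (- r) r).
  by apply: measurable_preimage;
    [exact: measurable_shift_rV|exact: measurable_cube].
apply: (@le_trans _ _ (lebesgue_rV ((fun x => (x - c)%R) @^-1` @cube n (- r) r))).
  apply: le_measure; rewrite ?inE//; first exact: measurable_ball_rV.
  move=> x [_ cx] i /=; have /ltr_normlP[] := cx ord0 i.
  by rewrite in_itv/= !mxE => *; apply/andP; split; lra.
rewrite lebesgue_rV_shift; last exact: measurable_cube.
rewrite lebesgue_cube; last lra.
rewrite opprK lee_fin; case: n n1 {c mC} => // n _.
by rewrite exprS ler_piMr ?exprn_ile1//; lra.
Qed.

End lebesgue_rV_theory.

(** * A countable base of balls *)

Section rational_balls.
Variables (R : realType) (n : nat).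
Local Notation V := 'rV[R]_n.

(** An enumeration of the balls with rational centre and radius
[1 / (m + 1)]; indices that encode no such ball give the empty set. *)
Definition rat_ball (k : nat) : set V :=
  if unpickle k is Some p
  then ball ((\row_i ratr ((p : 'rV[rat]_n * nat).1 ord0 i)) : V) (p.2.+1%:R^-1 : R)
  else set0.

Lemma measurable_rat_ball k : measurable (rat_ball k).
Proof. by rewrite /rat_ball; case: unpickle => // p; exact: measurable_ball_rV. Qed.

Lemma rat_ball_small (x : V) (e : R) : (0 < e)%R ->
  exists k, rat_ball k x /\ rat_ball k `<=` ball x e.
Proof.
move=> e0.
have [k ke] : exists k : nat, (k.+1%:R^-1 < e / 2 :> R)%R.
  have e2 : (0 < e / 2 :> R)%R by rewrite divr_gt0.
  by have [k _ /(_ _ (leqnn k)) ke] := near_infty_natSinv_lt (PosNum e2); exists k.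
have kx i : exists q : rat, ball (x ord0 i) (k.+1%:R^-1 : R) (ratr q).
  have /rat_in_itvoo[q] : (x ord0 i - k.+1%:R^-1 < x ord0 i + k.+1%:R^-1 :> R)%R.
    by rewrite ltrD2l gt0_cp// invr_gt0.
  by exists q; rewrite ball_itv.
have [g gx] := choice kx.
pose p := (\row_i g i, k) : 'rV[rat]_n * nat.
exists (pickle p); rewrite /rat_ball pickleK.
set c : V := \row_i _; have cx : ball c (p.2.+1%:R^-1 : R) x.
  by split => [|i j]; rewrite ?invr_gt0//= !mxE (ord1 i); apply: ball_sym.
split=> // y cy; apply: (@le_ball _ _ _ (k.+1%:R^-1 + k.+1%:R^-1)).
  by rewrite [leRHS]splitr lerD// ltW.
by apply: ball_triangle cy; exact: ball_sym.
Qed.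

Lemma bigcap_ball (x : V) : \bigcap_m ball x (m.+1%:R^-1 : R) = [set x].
Proof.
apply/seteqP; split=> [y xy|_ -> m _]; last exact: ballxx.
apply/eqP; apply/negPn/negP => yx.
have yx0 : (0 < `|x - y|)%R by rewrite normr_gt0 subr_eq0 eq_sym.
have [k _ /(_ _ (leqnn k)) ke] := near_infty_natSinv_lt (PosNum yx0).
have := xy k Logic.I; rewrite -ball_normE/= => /(lt_trans ke).
by rewrite ltxx.
Qed.

Lemma measurable_set1_rV (x : V) : measurable [set x].
Proof.
by rewrite -bigcap_ball; apply: bigcap_measurable => // m _;
  exact: measurable_ball_rV.
Qed.

Lemma bigcup_ball0 : \bigcup_m ball (0%R : V) (m.+1%:R : R) = setT.
Proof.
apply/seteqP; split=> // x _; exists (Num.truncn `|x|) => //.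
by rewrite -ball_normE/= sub0r normrN truncnS_gt.
Qed.

Lemma measurable_fun_subr_rV d (T : measurableType d) (f g : T -> V) :
  measurable_fun setT f -> measurable_fun setT g ->
  measurable_fun setT (fun t => (f t - g t)%R).
Proof.
move=> mf mg; apply: measurable_fun_rVP => i; under eq_fun do rewrite !mxE.
apply: measurable_funB.
  exact: (measurableT_comp (@measurable_coord_rV R n i) mf).
exact: (measurableT_comp (@measurable_coord_rV R n i) mg).
Qed.

End rational_balls.

(** * Configurations: joint measurability and atoms *)

Section configuration_theory.
Variables (R : realType) (n : nat).
Local Notation V := 'rV[R]_n.
Local Notation conf := (configuration R n).

Lemma measurable_config_eval (B : set V) : measurable B ->
  measurable_fun [set: conf] (fun pi : conf => pi B).
Proof.
move=> mB _ Y mY; apply: sub_sigma_algebra.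
by exists B => //; exists Y.
Qed.

Section kernel.
Context d (X : measurableType d) (g : X -> conf).
Hypothesis mg : measurable_fun setT g.

Let k (x : X) : {measure set V -> \bar R} := config_measure (g x).

Let measurable_k U : measurable U -> measurable_fun [set: X] (k ^~ U).
Proof.
by move=> mU; exact: (measurableT_comp (measurable_config_eval mU) mg).
Qed.

HB.instance Definition _ := isKernel.Build _ _ _ _ _ k measurable_k.

Lemma config_ball_lty (pi : conf) (c : V) (r : R) : pi (ball c r) < +oo.
Proof.
apply: config_locally_finite; first exact: measurable_ball_rV.
exists (`|c| + r)%R; split; first by rewrite num_real.
move=> s crs x; rewrite -ball_normE/= => cx.
rewrite -[x](subrK c) (le_trans (ler_normD _ _))// distrC.
by rewrite ltW// (lt_trans _ crs)// addrC ltrD2l.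
Qed.

(** The configuration need not be a uniformly bounded kernel in [x], so the mass
of a section is obtained as the limit of its masses in growing balls. *)
Lemma measurable_config_xsection (S : set (X * V)) : measurable S ->
  measurable_fun setT (fun x => g x (xsection S x)).
Proof.
move=> mS; pose D m := ball (0%R : V) (m.+1%:R : R).
have mD m : measurable (D m) by exact: measurable_ball_rV.
apply: (@emeasurable_fun_cvg _ _ _ _ (fun m x => k x (xsection S x `&` D m))).
  move=> m;
    have [|_ +//] := @measurable_prod_subset_xsection_kernel _ _ _ _ _ k _ (mD m) _ S mS.
  move=> x; exists (fine (k x (D m)) + 1)%R => Y mY.
  rewrite EFinD fineK; last by rewrite ge0_fin_numE// config_ball_lty.
  apply: (@le_lt_trans _ _ (k x (D m))); last first.
    by rewrite lteDl// ge0_fin_numE// config_ball_lty.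
  by rewrite /mrestr; apply: le_measure; rewrite ?inE//; exact: measurableI.
move=> x _.
rewrite [X in _ --> g x X](_ : _ = \bigcup_m (xsection S x `&` D m)); last first.
  by rewrite -setI_bigcupr bigcup_ball0 setIT.
have mSD m : measurable (xsection S x `&` D m).
  by apply: measurableI => //; exact: measurable_xsection.
apply: nondecreasing_cvg_mu => //; first exact: bigcup_measurable.
move=> a b ab; apply/subsetPset; apply: setIS; apply: le_ball.
by rewrite ler_nat.
Qed.

End kernel.

Lemma config_gt0_ge1 (pi : conf) (B : set V) : measurable B ->
  0 < pi B -> 1 <= pi B.
Proof.
move=> mB; have [piB|] := ltP (pi B) +oo; last by rewrite leye_eq => /eqP -> _;
  rewrite leey.
have [k ->] := config_integer_valued mB piB.
by rewrite lte_fin lee_fin ltr0n ler1n.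
Qed.

(** A configuration is purely atomic: any point of [B] outside the rational balls
[D] such that [B] has no mass in [D] is an atom, because all its neighbourhoods
in [B] have mass at least one. *)
Lemma config_atom (pi : conf) (B : set V) : measurable B ->
  0 < pi B -> pi B < +oo -> exists2 x, B x & 0 < pi [set x].
Proof.
move=> mB B0 Boo.
pose N := \bigcup_k (if `[< pi (B `&` @rat_ball R n k) = 0 >] then B `&` @rat_ball R n k else set0).
have mN : measurable N.
  apply: bigcup_measurable => k _; case: ifP => // _; apply: measurableI => //.
  exact: measurable_rat_ball.
have N0 : pi N = 0.
  apply: (@measure_negligible _ _ _ (config_measure pi) N mN);
    apply: (@negligible_bigcup _ _ _ (config_measure pi)) => k /=.
  case: ifPn => [/asboolP B0k|_]; last exact: negligible_set0.
  exists (B `&` @rat_ball R n k); split=> //; apply: measurableI => //.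
  exact: measurable_rat_ball.
have [x [Bx Nx]] : exists x, B x /\ ~ N x.
  apply: contrapT => h; move: B0; rewrite ltNge => /negP; apply.
  rewrite -N0; apply: le_measure; rewrite ?inE//.
  by move=> x Bx; apply: contrapT => Nx; apply: h; exists x.
have mBb m : measurable (B `&` ball x (m.+1%:R^-1 : R)).
  by apply: measurableI => //; exact: measurable_ball_rV.
exists x => //.
have Bx1 : B `&` [set x] = \bigcap_m (B `&` ball x (m.+1%:R^-1 : R)).
  rewrite -bigcap_ball; apply/seteqP; split=> y.
    by move=> [By xy] m _; split=> //; exact: xy.
  by move=> h; split=> [|m _]; [have [] := h 0%N Logic.I|have [] := h m Logic.I].
have : pi (B `&` ball x (m.+1%:R^-1 : R)) @[m --> \oo] --> pi (B `&` [set x]).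
  rewrite Bx1; apply: nonincreasing_cvg_mu => //.
  - apply: le_lt_trans Boo; apply: le_measure; rewrite ?inE//; exact: subIsetl.
  - exact: bigcap_measurable.
  - move=> a b ab; apply/subsetPset; apply: setIS; apply: le_ball.
    by rewrite lef_pV2 ?posrE// ler_nat.
move=> cv; apply: (@lt_le_trans _ _ 1) => //.
rewrite (_ : [set x] = B `&` [set x]); last first.
  by apply/seteqP; split=> [_ ->|y []].
apply: (cvge_ge _ cv); near=> m.
apply: config_gt0_ge1 => //.
rewrite lt_neqAle measure_ge0 andbT eq_sym; apply/eqP => pi0.
have [|k [kx kb]] := @rat_ball_small R n x (m.+1%:R^-1 : R);
  first by rewrite invr_gt0.
apply: Nx; exists k => //; rewrite ifT//; apply/asboolP/eqP.
rewrite eq_le measure_ge0 andbT -pi0; apply: le_measure; rewrite ?inE//.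
  by apply: measurableI => //; exact: measurable_rat_ball.
exact: setIS.
Unshelve. all: by end_near. Qed.

End configuration_theory.

(** * The greedy matching *)

Section construction.
Variables (R : realType) (n : nat).
Local Notation V := 'rV[R]_n.
Local Notation conf := (configuration R n).

(** A matching is encoded by a set [W] of triples [(pi, x, y)], meaning that in
[pi] the site [x] is matched to [y]. The load of [y] is the volume of the sites
matched to it. *)
Definition load (W : set (conf * V * V)) (q : conf * V) : \bar R :=
  lebesgue_rV [set x | W ((q.1, x), q.2)].

(** Given a matching [W], an unmatched site [x] proposes to the atom [y] of mass
one if [x - y] is in [D] and [x - D] has mass one; [y] is then the only atom
in [x - D]. Matched points being atoms, [x] is unmatched if and only if the
section of [W] at [x] has mass zero. *)
Definition proposal (D : set V) (W : set (conf * V * V)) : set (conf * V * V) :=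
  [set p : conf * V * V | [/\ D (p.1.2 - p.2)%R, p.1.1 [set y | D (p.1.2 - y)%R] = 1,
    p.1.1 [set p.2] = 1 & p.1.1 (xsection W p.1) = 0]].

(** The proposals made to [y] are all accepted if they do not raise its load above
one, and are all rejected otherwise. *)
Definition round D W : set (conf * V * V) :=
  W `|` [set p | proposal D W p /\ load (W `|` proposal D W) (p.1.1, p.2) <= 1].

(** The matching after [k] rounds. *)
Fixpoint stage k : set (conf * V * V) :=
  if k is k'.+1 then round (@rat_ball R n k') (stage k') else set0.

(** The final matching. *)
Definition matching : set (conf * V * V) := \bigcup_k stage k.

Lemma measurable_slice (W : set (conf * V * V)) pi y : measurable W ->
  measurable [set x | W ((pi, x), y)].
Proof.
move=> mW; have := @measurable_preimage _ _ _ _ (fun x : V => ((pi, x), y)) W _ mW.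
by apply; apply: measurable_fun_pair => //; apply: measurable_fun_pair.
Qed.

Lemma measurable_load W : measurable W -> measurable_fun setT (load W).
Proof.
move=> mW; pose h (q : conf * V * V) : conf * V * V := ((q.1.1, q.2), q.1.2).
have mh : measurable_fun setT h.
  apply: measurable_fun_pair.
    apply: measurable_fun_pair => //.
    by apply: measurableT_comp measurable_fst; exact: measurable_fst.
  by apply: (measurableT_comp _ measurable_fst); exact: measurable_snd.
have := measurable_fun_xsection (@lebesgue_rV R n) (measurable_preimage mh mW).
congr measurable_fun; apply/funext => q /=.
by rewrite xsectionE.
Qed.

Lemma measurable_near D : measurable D ->
  measurable [set p : conf * V * V | D (p.1.2 - p.2)%R].
Proof.
move=> mD;
  apply: (@measurable_preimage _ _ _ _ (fun p : conf * V * V => (p.1.2 - p.2)%R)) => //.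
apply: measurable_fun_subr_rV => //.
by apply: (measurableT_comp _ measurable_fst); exact: measurable_snd.
Qed.

Lemma measurable_singleton_mass :
  measurable_fun setT (fun q : conf * V => q.1 [set q.2]).
Proof.
pose S := [set p : conf * V * V | p.2 = p.1.2].
have mS : measurable S.
  pose h (p : conf * V * V) : V := (p.2 - p.1.2)%R.
  rewrite (_ : S = h @^-1` [set 0%R]).
    apply: measurable_preimage (measurable_set1_rV _).
    apply: measurable_fun_subr_rV => //.
    by apply: (measurableT_comp _ measurable_fst); exact: measurable_snd.
  apply/seteqP; split=> p; rewrite /h/S/= => h0.
    by rewrite h0 subrr.
  by apply/eqP; rewrite -subr_eq0 h0.
have := @measurable_config_xsection R n _ (conf * V)%type fst measurable_fst _ mS.
by congr measurable_fun; apply/funext => q; rewrite xsectionE.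
Qed.

Lemma measurable_proposal D W : measurable D -> measurable W ->
  measurable (proposal D W).
Proof.
move=> mD mW.
rewrite (_ : proposal D W =
  [set p : conf * V * V | D (p.1.2 - p.2)%R] `&`
  ((fun p : conf * V * V =>
      p.1.1 (xsection [set p : conf * V * V | D (p.1.2 - p.2)%R] p.1)) @^-1` [set 1] `&`
  ((fun p : conf * V * V => p.1.1 [set p.2]) @^-1` [set 1] `&`
  (fun p : conf * V * V => p.1.1 (xsection W p.1)) @^-1` [set 0]))); last first.
  apply/seteqP; split=> p; rewrite /proposal/= !xsectionE/=.
    by move=> [].
  by move=> [? [? []]].
have m1 := measurable_near mD.
apply: measurableI => //; apply: measurableI; last apply: measurableI.
- apply: measurable_preimage (emeasurable_set1 _).
  have h := @measurable_config_xsection R n _ (conf * V)%type fst measurable_fst _ m1.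
  exact: (measurableT_comp h measurable_fst).
- apply: (measurable_preimage _ (emeasurable_set1 _)).
  apply: (measurableT_comp measurable_singleton_mass (g := fun p : conf * V * V => (p.1.1, p.2))).
  apply: measurable_fun_pair => //.
  by apply: (measurableT_comp _ measurable_fst); exact: measurable_fst.
- apply: measurable_preimage (emeasurable_set1 _).
  have h := @measurable_config_xsection R n _ (conf * V)%type fst measurable_fst _ mW.
  exact: (measurableT_comp h measurable_fst).
Qed.

Lemma measurable_round D W : measurable D -> measurable W ->
  measurable (round D W).
Proof.
move=> mD mW; have mP := measurable_proposal mD mW.
apply: measurableU => //; apply: measurableI => //.
apply: (@measurable_preimage _ _ _ _
  (fun p : conf * V * V => load (W `|` proposal D W) (p.1.1, p.2)) `]-oo, 1]).
  apply: (measurableT_comp (measurable_load (measurableU _ _ mW mP))).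
  apply: measurable_fun_pair => //.
  by apply: (measurableT_comp _ measurable_fst); exact: measurable_fst.
exact: emeasurable_itv.
Qed.

Lemma measurable_stage k : measurable (stage k).
Proof.
elim: k => [|k IH] /=; first exact: measurable0.
by apply: measurable_round => //; exact: measurable_rat_ball.
Qed.

Lemma measurable_matching : measurable matching.
Proof. by apply: bigcup_measurable => k _; exact: measurable_stage. Qed.

End construction.

(** * Equivariance of the matching *)

Section equivariance.
Variables (R : realType) (n : nat).
Local Notation V := 'rV[R]_n.
Local Notation conf := (configuration R n).
Implicit Types (W : set (conf * V * V)) (pi : conf).

Lemma translateE z pi B : translate z pi B = pi ((fun x => (x + z)%R) @^-1` B).
Proof. by []. Qed.

Lemma translate_set1 z pi (y : V) : translate z pi [set (y + z)%R] = pi [set y].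
Proof.
rewrite translateE; congr (pi _); apply/seteqP; split=> x /=; last by move=> ->.
exact: addIr.
Qed.

(** Invariance of a set of triples under simultaneous translation of the
configuration, the site and the atom. *)
Definition equivariant W := forall (z : V) pi x y,
  W (translate z pi, x + z, y + z)%R <-> W (pi, x, y).

Lemma equivariant_xsection W z pi x (B : set V) : equivariant W ->
  translate z pi (B `&` xsection W (translate z pi, x + z)%R) =
  pi ((fun x => x + z)%R @^-1` B `&` xsection W (pi, x)).
Proof.
move=> eW; rewrite translateE !xsectionE; congr (pi _).
by apply/seteqP; split=> y /= [By /eW h]; split.
Qed.

Lemma equivariant_load W z pi y : measurable W -> equivariant W ->
  load W (translate z pi, y + z)%R = load W (pi, y).
Proof.
move=> mW eW; rewrite /load/=.
rewrite -(lebesgue_rV_shift z); last exact: measurable_slice.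
by congr lebesgue_rV; apply/seteqP; split=> x /= /eW.
Qed.

Lemma equivariant_proposal D W : equivariant W -> equivariant (proposal D W).
Proof.
move=> eW z pi x y; rewrite /proposal/= translate_set1.
have -> : translate z pi [set y | D (x + z - y)%R] = pi [set y | D (x - y)%R].
  rewrite translateE; congr (pi _).
  by apply/seteqP; split=> t /=; rewrite opprD addrACA subrr addr0.
have := @equivariant_xsection W z pi x setT eW; rewrite !setTI => ->.
by rewrite opprD addrACA subrr addr0.
Qed.

Lemma equivariant_round D W : measurable D -> measurable W -> equivariant W ->
  equivariant (round D W).
Proof.
move=> mD mW eW z pi x y.
have eP := equivariant_proposal D eW.
have eU : equivariant (W `|` proposal D W).
  by move=> z' pi' x' y'; split=> -[/eW|/eP]; [left|right|left|right].
have mU : measurable (W `|` proposal D W).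
  by apply: measurableU => //; exact: measurable_proposal.
rewrite /round/=; rewrite equivariant_load//.
by split=> -[/eW|[/eP ? ?]]; [left|right|left|right].
Qed.

Lemma equivariant_stage k : equivariant (@stage R n k).
Proof.
elim: k => [//|k IH]; apply: equivariant_round => //.
  exact: measurable_rat_ball.
exact: measurable_stage.
Qed.

Lemma equivariant_matching : equivariant (@matching R n).
Proof.
by move=> z pi x y; split=> -[k _ /equivariant_stage h]; exists k.
Qed.

End equivariance.

(** * Loads of the matching, and its exhaustiveness *)

Section matching_theory.
Variables (R : realType) (n : nat).
Local Notation V := 'rV[R]_n.
Local Notation conf := (configuration R n).
Local Notation matching := (@matching R n).
Local Notation stage := (@stage R n).
Implicit Types (W : set (conf * V * V)) (pi : conf).

Lemma stage_nondecreasing k l : (k <= l)%N -> stage k `<=` stage l.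
Proof.
elim: l => [|l IH]; first by rewrite leqn0 => /eqP ->.
by rewrite leq_eqVlt => /predU1P[->//|/IH h] p /h ?; left.
Qed.

Lemma stage_atom k p : stage k p -> p.1.1 [set p.2] = 1.
Proof. by elim: k => //= k IH [/IH//|[[]]]. Qed.

Lemma matching_atom pi x y : matching (pi, x, y) -> pi [set y] = 1.
Proof. by move=> [k _ /stage_atom]. Qed.

Lemma stage_null k pi x : pi (xsection (stage k) (pi, x)) = 0 ->
  forall y, ~ stage k (pi, x, y).
Proof.
move=> h y ky; have := stage_atom ky => /= y1.
suff : 1 <= 0 :> \bar R by rewrite lee_fin ler10.
rewrite -y1 -h; apply: le_measure; rewrite ?inE.
- exact: measurable_set1_rV.
- by apply: measurable_xsection; exact: measurable_stage.
- by rewrite xsectionE => _ ->.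
Qed.

Lemma config_two_atoms pi (B : set V) x y : measurable B -> pi B = 1 ->
  B x -> B y -> pi [set x] = 1 -> pi [set y] = 1 -> x = y.
Proof.
move=> mB B1 Bx By x1 y1; apply: contrapT => xy.
suff : 1 + 1 <= 1 :> \bar R by rewrite -EFinD lee_fin; lra.
rewrite -[leRHS]B1 -[X in X + _]x1 -[X in _ + X]y1.
have mx := measurable_set1_rV x; have my := measurable_set1_rV y.
rewrite -measureU//; last first.
  by apply/seteqP; split=> // t [/= -> /xy].
by apply: le_measure; rewrite ?inE//; [exact: measurableU|move=> t [->|->]].
Qed.

Lemma measurable_near_slice (D : set V) (x : V) : measurable D ->
  measurable [set y | D (x - y)%R].
Proof.
move=> mD; have mf : measurable_fun setT (fun y : V => (x - y)%R : V).
  by apply: measurable_fun_subr_rV => //; exact: measurable_cst.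
exact: measurable_preimage mf mD.
Qed.

Lemma stage_functional k pi x y y' :
  stage k (pi, x, y) -> stage k (pi, x, y') -> y = y'.
Proof.
elim: k => // k IH [h|[[h1 h2 h3 h4] _]] [h'|[[h1' h2' h3' h4'] _]].
- exact: IH.
- by case: (stage_null h4' h).
- by case: (stage_null h4 h').
- apply: config_two_atoms h2 _ _ h3 h3' => //.
  by apply: measurable_near_slice; exact: measurable_rat_ball.
Qed.

Lemma matching_functional pi x y y' :
  matching (pi, x, y) -> matching (pi, x, y') -> y = y'.
Proof.
move=> [k _ hk] [l _ hl]; apply: (@stage_functional (maxn k l) pi x).
- by apply: stage_nondecreasing hk; rewrite leq_maxl.
- by apply: stage_nondecreasing hl; rewrite leq_maxr.
Qed.

(** Round by round, the set matched to [y] either does not change, or becomes its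
union with the proposals, of volume at most one by acceptance. *)
Lemma stage_load_le1 k q : load (stage k) q <= 1.
Proof.
elim: k => [|k IH] /=; first by rewrite /load measure0.
case: q IH => pi y IH.
rewrite /round; set P := proposal _ _;
  have [h|h] := leP (load (stage k `|` P) (pi, y)) 1.
  rewrite (_ : load _ _ = load (stage k `|` P) (pi, y))//.
  congr lebesgue_rV; apply/seteqP; split=> x /= [h1|h1];
    [by left|by right; case: h1|by left|].
  by right.
rewrite (_ : load _ _ = load (stage k) (pi, y))//.
congr lebesgue_rV; apply/seteqP; split=> x /=; last by left.
by move=> [//|[_]]; rewrite leNgt h.
Qed.

Lemma stage_load_cvg q : load (stage k) q @[k --> \oo] --> load matching q.
Proof.
rewrite (_ : load matching q =
    lebesgue_rV (\bigcup_k [set x | stage k (q.1, x, q.2)])).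
  apply: nondecreasing_cvg_mu.
  - by move=> k; apply: measurable_slice; exact: measurable_stage.
  - by apply: bigcup_measurable => k _; apply: measurable_slice;
    exact: measurable_stage.
  - by move=> k l kl; apply/subsetPset => x; exact: stage_nondecreasing.
by congr lebesgue_rV; apply/seteqP; split=> x [k _ h]; exists k.
Qed.

Lemma matching_load_le1 q : load matching q <= 1.
Proof.
by apply: (cvge_le _ (@stage_load_cvg q)); apply: nearW => k; exact: stage_load_le1.
Qed.

Lemma atom_isolated pi (y : V) : pi [set y] = 1 ->
  exists2 e : R, (0 < e)%R & pi (ball y e) = 1.
Proof.
move=> y1; pose F m := ball y (m.+1%:R^-1 : R) `\ y.
have mF m : measurable (F m).
  by apply: measurableD; [exact: measurable_ball_rV|exact: measurable_set1_rV].
have F0 : \bigcap_m F m = set0.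
  apply/seteqP; split=> // x h; have [_] := h 0%N Logic.I; apply.
  by rewrite -bigcap_ball => m _; have [] := h m Logic.I.
have Foo m : pi (F m) < +oo.
  apply: le_lt_trans (config_ball_lty pi y (m.+1%:R^-1)).
  by apply: le_measure; rewrite ?inE//; [exact: measurable_ball_rV|exact: subDsetl].
have : pi (F m) @[m --> \oo] --> pi (\bigcap_m F m).
  apply: nonincreasing_cvg_mu => //; first exact: bigcap_measurable.
  move=> a b ab; apply/subsetPset; apply: setSD; apply: le_ball.
  by rewrite lef_pV2 ?posrE// ler_nat.
rewrite F0 measure0 => cv.
have [m Fm] : exists m, pi (F m) < 1.
  have : \forall m \near \oo, pi (F m) < 1.
    apply: (cv [set z | z < 1]); apply: open_nbhs_nbhs; split.
      exact: open_ereal_lt_ereal.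
    by rewrite /= lte_fin.
  by move=> [m _ /(_ _ (leqnn m))]; exists m.
exists (m.+1%:R^-1)%R; first by rewrite invr_gt0.
have -> : ball y (m.+1%:R^-1 : R) = [set y] `|` F m.
  rewrite /F setDE setUIr setUv setIT; apply/esym/setUidPr => _ ->.
  by apply: ballxx; rewrite invr_gt0.
rewrite measureU//; [|exact: measurable_set1_rV|by rewrite /F setDIK].
rewrite -[RHS]adde0 -[in RHS]y1; congr (_ + _).
apply/eqP; rewrite eq_le measure_ge0 andbT leNgt; apply/negP => F_gt0.
by have := config_gt0_ge1 (mF m) F_gt0; rewrite leNgt Fm.
Qed.

(** An atom of load less than one would accept any site still unmatched in the
round of a small enough ball. *)
Lemma matching_exhaustive pi y : (1 <= n)%N -> pi [set y] = 1 ->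
  load matching (pi, y) < 1 -> forall x, exists y', matching (pi, x, y').
Proof.
move=> n1 y1 ly x; apply: contrapT => nx.
have nmx k : pi (xsection (stage k) (pi, x)) = 0.
  rewrite (_ : xsection _ _ = set0) ?measure0//.
  by rewrite xsectionE; apply/seteqP; split=> // t kt; apply: nx; exists t, k.
have l0 : 0 <= load matching (pi, y) by exact: measure_ge0.
have lfin : load matching (pi, y) \is a fin_num.
  by rewrite ge0_fin_numE// (lt_trans ly)// ltry.
set l := fine (load matching (pi, y)).
have lE : load matching (pi, y) = l%:E by rewrite fineK.
have [e e0 ye] := atom_isolated y1.
have l1 : (l < 1)%R by rewrite -lte_fin -lE.
(* Within [e] of [y] there is no other atom, and a ball of radius [(1 - l) / 2]
   has volume at most [1 - l]. *)
pose r := Num.min e ((1 - l) / 2)%R.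
have r0 : (0 < r)%R by rewrite lt_min e0/=; lra.
have re : (r <= e)%R by rewrite ge_min lexx.
have rl : (r + r <= 1 - l)%R.
  by have : (r <= (1 - l) / 2)%R; [rewrite ge_min lexx orbT|lra].
have l_ge0 : (0 <= l)%R by rewrite -lee_fin -lE.
have [k [kx kr]] := rat_ball_small (x - y)%R r0.
have mk := @measurable_rat_ball R n k.
have Pk : proposal (@rat_ball R n k) (stage k) (pi, x, y).
  split=> //=; apply/eqP; rewrite eq_le; apply/andP; split.
    rewrite -ye; apply: le_measure; rewrite ?inE.
    - exact: measurable_near_slice.
    - exact: measurable_ball_rV.
    move=> t /kr; rewrite -!ball_normE/= opprB addrC addrA subrK distrC => h.
    exact: lt_le_trans h re.
  rewrite -y1; apply: le_measure; rewrite ?inE.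
  - exact: measurable_set1_rV.
  - exact: measurable_near_slice.
  - by move=> _ ->.
suff : stage k.+1 (pi, x, y) by move=> h; apply: nx; exists y, k.+1.
right; split=> //=.
have mS : measurable [set x | matching (pi, x, y)].
  by apply: measurable_slice; exact: measurable_matching.
have mB : measurable ((fun t => (t - y)%R) @^-1` (@rat_ball R n k)).
  by apply: measurable_preimage => //; exact: measurable_shift_rV.
apply: (@le_trans _ _ (lebesgue_rV ([set x | matching (pi, x, y)] `|`
    (fun t => (t - y)%R) @^-1` (@rat_ball R n k)))).
  apply: le_measure; rewrite ?inE.
  - apply: (@measurable_slice _ _ (stage k `|` _)); apply: measurableU.
      exact: measurable_stage.
    by apply: measurable_proposal => //; exact: measurable_stage.
  - exact: measurableU.
  by move=> t [h|[h _ _ _]]; [left; exists k|right].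
apply: (le_trans (measureU2 _ mS mB)).
apply: (@le_trans _ _ (l%:E + (r + r)%:E)); last by rewrite -EFinD lee_fin; lra.
apply: leeD; first by rewrite -lE.
rewrite [leLHS](lebesgue_rV_shift (- y)%R mk).
apply: le_trans (lebesgue_ball_le (x - y)%R n1 r0 _); last lra.
by apply: le_measure; rewrite ?inE//; exact: measurable_ball_rV.
Qed.

End matching_theory.

(** * Unit cells of the integer lattice *)

Section lattice_cells.
Variables (R : realType) (n : nat).
Local Notation V := 'rV[R]_n.

(** The unit cell at the lattice point [w]: the points with integer part [w]. *)
Definition cell (w : 'rV[int]_n) : set V :=
  [set x | forall i, Num.floor (x ord0 i) = w ord0 i].

(** The lattice point [w] as an element of [R^n]. *)
Definition int_rV (w : 'rV[int]_n) : V := \row_i (w ord0 i)%:~R.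

Lemma cell0 : cell 0 = @cube R n 0 1.
Proof.
apply/seteqP; split=> x h i.
  have := h i; rewrite mxE => h0; rewrite in_itv/=.
  have /andP[] := floor_itv (x ord0 i); rewrite h0 add0r.
  by move=> -> ->.
have := h i; rewrite in_itv/= mxE => hx; apply: floor_def.
by rewrite add0r.
Qed.

Lemma cell_shift u w :
  (fun x => (x + int_rV u)%R) @^-1` cell w = cell (w - u).
Proof.
apply/seteqP; split=> x h i; have := h i; rewrite !mxE floorDrz ?intr_int//.
  by rewrite intrKfloor => <-; rewrite addrK.
by rewrite intrKfloor => ->; rewrite subrK.
Qed.

Lemma cell_shift0 w : cell w = (fun x => (x + int_rV (- w))%R) @^-1` cell 0.
Proof. by rewrite cell_shift sub0r opprK. Qed.

Lemma measurable_cell w : measurable (cell w).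
Proof.
rewrite cell_shift0 cell0; apply: measurable_preimage (measurable_cube _ _).
exact: measurable_shift_rV.
Qed.

Lemma lebesgue_cell w : lebesgue_rV (cell w) = 1.
Proof.
rewrite cell_shift0 lebesgue_rV_shift; last exact: measurable_cell.
by rewrite cell0 lebesgue_cube ?ler01// subr0 expr1n.
Qed.

Lemma cell_bounded w (pi : configuration R n) : pi (cell w) < +oo.
Proof.
have mw := measurable_cell w.
apply: config_locally_finite => //.
exists (\sum_i (`|w ord0 i|%:~R + 1))%R; split; first by rewrite num_real.
move=> M Mw x h /=.
have M0 : (0 <= M)%R.
  apply: le_trans (ltW Mw); apply: sumr_ge0 => i _.
  by rewrite addr_ge0// ler0z.
rewrite [leLHS]/Num.Def.normr/= mx_normrE; apply/bigmax_leP; split=> // -[i j] _ /=.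
rewrite (ord1 i : i = ord0); apply: le_trans (ltW Mw); rewrite (bigD1 j)//=.
apply: (@le_trans _ _ (`|w ord0 j|%:~R + 1)%R); last first.
  by rewrite lerDl; apply: sumr_ge0 => k _; rewrite addr_ge0// ler0z.
have /andP[h1 h2] := floor_itv (x ord0 j); rewrite h in h1 h2.
rewrite intrD1 in h2; rewrite intr_norm.
have := ler_norm ((w ord0 j)%:~R : R); have := ler_norm (- (w ord0 j)%:~R : R);
  rewrite normrN => ? ?.
by rewrite ler_norml; apply/andP; split; lra.
Qed.

(** The cells at the points [s w], as a sequence. As [pickle_inv] reaches each
lattice point exactly once, the sequence is a partition of the space when [s]
is a bijection; the indices that it skips give empty sets. *)
Definition nat_cell (s : 'rV[int]_n -> 'rV[int]_n) (j : nat) : set V :=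
  if pickle_inv j is Some w then cell (s w) else set0.

Lemma measurable_nat_cell s j : measurable (nat_cell s j).
Proof. by rewrite /nat_cell; case: pickle_inv => // w; exact: measurable_cell. Qed.

Lemma bigcup_nat_cell s : (forall w, exists w', s w' = w) ->
  \bigcup_j nat_cell s j = setT.
Proof.
move=> h; apply/seteqP; split=> // x _.
have [w' hw'] := h (\row_i Num.floor (x ord0 i)).
by exists (pickle w') => //; rewrite /nat_cell pickleK_inv hw' => i; rewrite mxE.
Qed.

Lemma trivIset_nat_cell s : injective s -> trivIset setT (nat_cell s).
Proof.
move=> si; apply/trivIsetP => i j _ _ ij; apply/seteqP; split=> // x [].
rewrite /nat_cell.
have := @pickle_invK 'rV[int]_n i; have := @pickle_invK 'rV[int]_n j.
case: (pickle_inv j) => [w'|//] /= ij';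
  case: (pickle_inv i) => [w|//] /= ii' hw hw'.
have ww : w = w' by apply/si/rowP => k; rewrite -hw -hw'.
by move: ij; rewrite -ii' -ij' ww eqxx.
Qed.

End lattice_cells.

(** * Mass transport *)

Section mass_transport.
Variables (R : realType) (n : nat).
Local Notation V := 'rV[R]_n.
Local Notation conf := (configuration R n).
Implicit Types (W : set (conf * V * V)) (pi : conf) (A B : set V).

Lemma config_sigma_finite pi : sigma_finite setT pi.
Proof.
exists (fun m => ball (0%R : V) (m.+1%:R : R)); first by rewrite bigcup_ball0.
by move=> m; split; [exact: measurable_ball_rV|exact: config_ball_lty].
Qed.

(** A configuration as a sigma-finite measure, for use with Fubini. *)
Definition config_sfm pi : {sigma_finite_measure set V -> \bar R} :=
  sigma_finite_pack (measure0 pi) (measure_ge0 pi)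
    (@measure_semi_sigma_additive _ _ _ pi) (config_sigma_finite pi).

Lemma measurable_translate z : measurable_fun setT (@translate R n z).
Proof.
apply: (@measurability _ _ _ _ _ _
  (\bigcup_(B in @measurable _ V) preimage_set_system [set: conf]
          (fun pi : conf => pi B) measurable)) => //.
move=> _ [_ [B mB [Y mY <-]] <-]; rewrite !setTI.
have mB' : measurable ((fun x => (x + z)%R) @^-1` B).
  by apply: measurable_preimage => //; exact: measurable_shift_rV.
exact: (measurable_preimage (measurable_config_eval mB') mY).
Qed.

(** The triples of [W] with site in [A] and atom in [B]. *)
Definition restrict_pairs W A B : set (conf * V * V) :=
  [set p | [/\ A p.1.2, B p.2 & W p]].

(** The mass sent by [W] from the sites of [A] to the atoms of [B]. *)
Definition flux W pi A B : \bar R :=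
  \int[lebesgue_rV (n:=n)]_x pi (xsection (restrict_pairs W A B) (pi, x)).

Lemma measurable_restrict_pairs W A B : measurable W -> measurable A ->
  measurable B -> measurable (restrict_pairs W A B).
Proof.
move=> mW mA mB.
rewrite (_ : restrict_pairs _ _ _ =
  (fun p : conf * V * V => p.1.2) @^-1` A `&` (snd @^-1` B `&` W)); last first.
  by apply/seteqP; split=> p; [case|case=> ? []].
apply: measurableI; last apply: measurableI => //.
  apply: measurable_preimage mA.
  by apply: (measurableT_comp _ measurable_fst); exact: measurable_snd.
by apply: measurable_preimage mB.
Qed.

Lemma measurable_pair_slice W pi : measurable W ->
  measurable [set q : V * V | W (pi, q.1, q.2)].
Proof.
move=> mW;
  have := @measurable_preimage _ _ _ _ (fun q : V * V => ((pi, q.1), q.2)) W _ mW.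
by apply; apply: measurable_fun_pair => //; apply: measurable_fun_pair => //;
  exact: measurable_cst.
Qed.

Lemma flux_dual W pi A B : measurable W -> measurable A -> measurable B ->
  flux W pi A B = \int[pi]_y load (restrict_pairs W A B) (pi, y).
Proof.
move=> mW mA mB; have mS := measurable_restrict_pairs mW mA mB.
have := @indic_fubini_tonelli _ _ _ _ _ (@lebesgue_rV R n) (config_sfm pi) _
  (measurable_pair_slice pi mS).
rewrite indic_fubini_tonelli_FE; last exact: measurable_pair_slice.
rewrite indic_fubini_tonelli_GE; last exact: measurable_pair_slice.
rewrite /flux => h.
transitivity (\int[lebesgue_rV (n:=n)]_x
  (config_sfm pi \o xsection [set q | restrict_pairs W A B (pi, q.1, q.2)]) x).
  by apply: eq_integral => x _; rewrite /= !xsectionE.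
rewrite h; apply: eq_integral => y _ /=; congr lebesgue_rV.
by apply/seteqP; split=> x; rewrite /ysection/= in_setE.
Qed.

Lemma measurable_flux W A B : measurable W -> measurable A -> measurable B ->
  measurable_fun setT (fun pi => flux W pi A B).
Proof.
move=> mW mA mB; have mS := measurable_restrict_pairs mW mA mB.
apply: (@measurable_fun_fubini_tonelli_F _ _ _ _ _ (@lebesgue_rV R n)
  (fun q : conf * V => q.1 (xsection (restrict_pairs W A B) q))) => //.
exact: (@measurable_config_xsection R n _ (conf * V)%type fst measurable_fst _ mS).
Qed.

Lemma flux_ge0 W pi A B : 0 <= flux W pi A B.
Proof. by apply: integral_ge0 => x _; exact: measure_ge0. Qed.

Lemma flux_bigcupr W pi A (F : (set V)^nat) : measurable W -> measurable A ->
  (forall j, measurable (F j)) -> trivIset setT F ->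
  flux W pi A (\bigcup_j F j) = \sum_(j <oo) flux W pi A (F j).
Proof.
move=> mW mA mF tF; rewrite /flux -integral_nneseries//; last first.
  move=> j; have mS := measurable_restrict_pairs mW mA (mF j).
  rewrite [X in measurable_fun _ X](_ : _ = fun x => config_sfm pi
    (xsection [set q | restrict_pairs W A (F j) (pi, q.1, q.2)] x)).
    by apply: measurable_fun_xsection; exact: measurable_pair_slice.
  by apply/funext => x; rewrite !xsectionE.
apply: eq_integral => x _; rewrite -measure_semi_bigcup.
- congr (pi _); rewrite xsectionE; apply/seteqP; split=> y /=.
    by move=> [Ax [j _ Fj] Wy]; exists j => //; rewrite xsectionE.
  by move=> [j _]; rewrite xsectionE => -[? ? ?]; split=> //; exists j.
- by move=> j; apply: measurable_xsection; exact: measurable_restrict_pairs.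
- apply/trivIsetP => i j _ _ ij; apply/seteqP; split=> // y [].
  rewrite !xsectionE => -[_ Fi _] [_ Fj _].
  by move/trivIsetP : tF => /(_ i j I I ij) <-; split.
- by apply: bigcup_measurable => j _; apply: measurable_xsection;
  exact: measurable_restrict_pairs.
Qed.

Lemma flux_bigcupl W pi (F : (set V)^nat) B : measurable W -> measurable B ->
  (forall j, measurable (F j)) -> trivIset setT F ->
  flux W pi (\bigcup_j F j) B = \sum_(j <oo) flux W pi (F j) B.
Proof.
move=> mW mB mF tF; rewrite flux_dual//; last exact: bigcup_measurable.
under eq_eseriesr do rewrite flux_dual//.
rewrite -integral_nneseries//; last first.
  move=> j; have mS := measurable_restrict_pairs mW (mF j) mB.
  by apply: (measurableT_comp (measurable_load mS)); exact: measurable_fun_pair.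
apply: eq_integral => y _; rewrite /load -measure_semi_bigcup/=.
- congr lebesgue_rV; apply/seteqP; split=> x /=.
    by move=> [[j _ Fj] By Wy]; exists j.
  by move=> [j _ [? ? ?]]; split=> //; exists j.
- by move=> j; apply: measurable_slice; exact: measurable_restrict_pairs.
- apply/trivIsetP => i j _ _ ij; apply/seteqP; split=> // x [[Fi _ _] [Fj _ _]].
  by move/trivIsetP : tF => /(_ i j I I ij) <-; split.
- by apply: bigcup_measurable => j _; apply: measurable_slice;
  exact: measurable_restrict_pairs.
Qed.

Lemma flux_translate W pi z A B : measurable W -> equivariant W ->
  measurable A -> measurable B ->
  flux W (translate z pi) A B =
  flux W pi ((fun x => (x + z)%R) @^-1` A) ((fun x => (x + z)%R) @^-1` B).
Proof.
move=> mW eW mA mB.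
have mt : measurable_fun [set: V] (fun x : V => (x + z)%R : V) by exact: measurable_shift_rV.
have mS := measurable_restrict_pairs mW mA mB.
have -> : flux W (translate z pi) A B = \int[pushforward (@lebesgue_rV R n)
    (fun x : V => (x + z)%R : V)]_x translate z pi
    (xsection (restrict_pairs W A B) (translate z pi, x)).
  apply: eq_measure_integral => C mC _.
  exact/esym/(lebesgue_rV_shift z mC).
rewrite (ge0_integral_pushforward mt)//=; last first.
  rewrite [X in measurable_fun _ X](_ : _ = fun x => config_sfm (translate z pi)
    (xsection [set q | restrict_pairs W A B (translate z pi, q.1, q.2)] x)).
    by apply: measurable_fun_xsection; exact: measurable_pair_slice.
  by apply/funext => x; rewrite !xsectionE.
rewrite preimage_setT; apply: eq_integral => x _ /=.
rewrite translateE; congr (pi _); rewrite !xsectionE.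
by apply/seteqP; split=> y /= [? ? /eW ?]; split.
Qed.

Section invariant.
Variable Lam : probability conf R.
Hypothesis Lam_inv : translation_invariant Lam.

Lemma integral_translate z (f : conf -> \bar R) : measurable_fun setT f ->
  (forall pi, 0 <= f pi) ->
  \int[Lam]_pi f (translate z pi) = \int[Lam]_pi f pi.
Proof.
move=> mf f0; transitivity (\int[pushforward Lam (@translate R n z)]_pi f pi).
  by rewrite (ge0_integral_pushforward (measurable_translate z))// preimage_setT.
apply: eq_measure_integral; first exact: measurable_translate.
by move=> ? C mC _; exact: Lam_inv.
Qed.

(** The mean under [Lam] of the mass sent from [A] to [B]. *)
Definition mean_flux W A B := \int[Lam]_pi flux W pi A B.

Lemma mean_flux_shift W z A B : measurable W -> equivariant W ->
  measurable A -> measurable B ->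
  mean_flux W ((fun x => (x + z)%R) @^-1` A) ((fun x => (x + z)%R) @^-1` B) =
  mean_flux W A B.
Proof.
move=> mW eW mA mB.
transitivity (\int[Lam]_pi flux W (translate z pi) A B).
  by apply: eq_integral => pi _; rewrite flux_translate.
apply: (@integral_translate z (fun pi => flux W pi A B)).
  exact: measurable_flux.
by move=> pi; exact: flux_ge0.
Qed.

Lemma mean_flux_bigcupr W A (F : (set V)^nat) : measurable W -> measurable A ->
  (forall j, measurable (F j)) -> trivIset setT F ->
  mean_flux W A (\bigcup_j F j) = \sum_(j <oo) mean_flux W A (F j).
Proof.
move=> mW mA mF tF; rewrite /mean_flux -integral_nneseries//.
- by apply: eq_integral => pi _; exact: flux_bigcupr.
- by move=> j; exact: measurable_flux.
- by move=> j pi _; exact: flux_ge0.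
Qed.

Lemma mean_flux_bigcupl W (F : (set V)^nat) B : measurable W -> measurable B ->
  (forall j, measurable (F j)) -> trivIset setT F ->
  mean_flux W (\bigcup_j F j) B = \sum_(j <oo) mean_flux W (F j) B.
Proof.
move=> mW mB mF tF; rewrite /mean_flux -integral_nneseries//.
- by apply: eq_integral => pi _; exact: flux_bigcupl.
- by move=> j; exact: measurable_flux.
- by move=> j pi _; exact: flux_ge0.
Qed.

(** The mean mass sent out of a cell equals the mean mass received by it: the
mass sent from the cell at [w] to the one at [v] has the same mean as the mass
sent from the cell at [w + w - v] to the one at [w]. *)
Lemma mass_transport W w : measurable W -> equivariant W ->
  mean_flux W (@cell R n w) setT = mean_flux W setT (@cell R n w).
Proof.
move=> mW eW.
(* translating by [w - v] sends the cells at [w] and [v] to those at [s v]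
   and [w] *)
pose s (v : 'rV[int]_n) := (w + w - v)%R.
have sK : involutive s by move=> v; rewrite /s opprB addrC subrK.
have sS v : exists v', s v' = v by exists (s v); rewrite sK.
transitivity (mean_flux W (@cell R n w) (\bigcup_j nat_cell id j)).
  by rewrite bigcup_nat_cell// => v; exists v.
rewrite (mean_flux_bigcupr mW (measurable_cell w) (measurable_nat_cell id));
  last first.
  exact: trivIset_nat_cell.
transitivity (mean_flux W (\bigcup_j nat_cell s j) (@cell R n w)); last first.
  by rewrite bigcup_nat_cell.
rewrite (mean_flux_bigcupl mW (measurable_cell w) (measurable_nat_cell s));
  last first.
  by apply: trivIset_nat_cell; exact: inv_inj.
apply: eq_eseriesr => j _; rewrite /nat_cell; case: pickle_inv => [v|].
  rewrite -(mean_flux_shift (int_rV R (v - w)) mW eW (measurable_cell w) (measurable_cell v)).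
  by rewrite !cell_shift /s !opprB addrA (addrC v) subrK.
apply: eq_integral => pi _; apply: eq_integral => x _.
by congr (pi _); rewrite !xsectionE; apply/seteqP; split=> y [].
Qed.

End invariant.
End mass_transport.

(** * The allocation induced by the matching *)

Section allocation.
Variables (R : realType) (n : nat).
Local Notation V := 'rV[R]_n.
Local Notation conf := (configuration R n).
Local Notation matching := (@matching R n).
Implicit Types (pi : conf).

(** The sites of [pi] that are never matched. *)
Definition unmatched pi : set V := [set x | forall y, ~ matching (pi, x, y)].

Lemma matching_xsection_mass pi x :
  pi (xsection matching (pi, x)) = (\1_(~` unmatched pi) x)%:E.
Proof.
rewrite xsectionE indicE;
  have [nx|/existsNP[y /contrapT xy]] := pselect (unmatched pi x).
  rewrite (_ : [set y | _] = set0) ?measure0; last first.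
    by apply/seteqP; split=> // y /nx.
  by rewrite memNset//= => /(_ nx).
rewrite (_ : [set y | _] = [set y]); last first.
  by apply/seteqP; split=> [z xz|_ ->//]; exact: matching_functional xz xy.
by rewrite (matching_atom xy) mem_set// => /(_ y).
Qed.

Lemma measurable_unmatched : measurable [set q : conf * V | unmatched q.1 q.2].
Proof.
have h := @measurable_config_xsection R n _ (conf * V)%type fst measurable_fst _
  (@measurable_matching R n).
rewrite (_ : [set q | _] = (fun q : conf * V => q.1 (xsection matching q)) @^-1` [set 0]).
  exact: measurable_preimage h (emeasurable_set1 _).
apply/seteqP; split=> -[pi x] /=; rewrite matching_xsection_mass indicE.
  by move=> ux; rewrite memNset//= => /(_ ux).
by case: (boolP (x \in _)) => [_ [] /eqP|];
  rewrite ?oner_eq0// notin_setE => /contrapT.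
Qed.

Lemma measurable_unmatched_slice pi : measurable (unmatched pi).
Proof.
have := @measurable_xsection _ _ _ _ _ pi measurable_unmatched.
by rewrite xsectionE.
Qed.

Lemma unmatched_translate z pi x :
  unmatched (translate z pi) (x + z)%R <-> unmatched pi x.
Proof.
split=> ux y.
  by move/(equivariant_matching z) => /ux.
by rewrite -(subrK z y) => /equivariant_matching /ux.
Qed.

Lemma flux_out pi A : measurable A ->
  flux matching pi A setT = lebesgue_rV (A `\` unmatched pi).
Proof.
move=> mA; have mU := measurable_unmatched_slice pi.
transitivity (\int[lebesgue_rV (n:=n)]_x (\1_(A `\` unmatched pi) x)%:E).
  apply: eq_integral => x _; rewrite xsectionE setDE indicI.
  rewrite /= EFinM -matching_xsection_mass indicE.
  have [xA|xA] := boolP (x \in A).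
    rewrite mul1e xsectionE; congr (pi _); apply/seteqP; split=> y /=;
      first by case.
    by rewrite inE in xA.
  rewrite mul0e (_ : [set y | _] = set0) ?measure0//.
  by apply/seteqP; split=> // y [/mem_set]; rewrite (negbTE xA).
by rewrite integral_indic ?setIT//; exact: measurableD.
Qed.

Lemma flux_in pi B : measurable B ->
  flux matching pi setT B = \int[pi]_(y in B) load matching (pi, y).
Proof.
move=> mB; rewrite flux_dual//; last exact: measurable_matching.
rewrite [RHS]integral_mkcond; apply: eq_integral => y _.
rewrite patchE /load/=; case: ifPn => [yB|yB].
  congr lebesgue_rV; apply/seteqP; split=> x /=; first by case.
  by rewrite inE in yB.
rewrite (_ : [set x | _] = set0) ?measure0//.
by apply/seteqP; split=> // x [_ /mem_set]; rewrite (negbTE yB).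
Qed.

Lemma measurable_load_slice pi : measurable_fun setT (fun y => load matching (pi, y)).
Proof.
by apply: (measurableT_comp (measurable_load (@measurable_matching R n)));
  exact: measurable_fun_pair.
Qed.

Lemma flux_in_le pi B : measurable B -> flux matching pi setT B <= pi B.
Proof.
move=> mB; rewrite flux_in// -[leRHS]mul1e -integral_cst//.
apply: ge0_le_integral => //.
- by apply: measurable_funTS; exact: measurable_load_slice.
- by move=> y _; exact: matching_load_le1.
Qed.

Lemma flux_in_full pi B : measurable B -> pi B < +oo ->
  (forall y, 0 < pi [set y] -> pi [set y] = 1) ->
  (forall y, support pi y -> load matching (pi, y) = 1) ->
  flux matching pi setT B = pi B.
Proof.
move=> mB Boo pi_simple full; rewrite flux_in// -[RHS]mul1e -integral_cst//.
have mL := measurable_load_slice pi.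
pose N := B `&` (fun y => load matching (pi, y)) @^-1` (~` [set 1]).
have mN : measurable N.
  by apply: measurableI => //; apply: measurable_preimage => //; exact: measurableC.
apply: ge0_ae_eq_integral => //; first exact: measurable_funTS.
exists N; split=> //.
  apply/eqP; rewrite eq_le measure_ge0 andbT leNgt; apply/negP => N0.
  have [|y [_ /= ny] y0] := config_atom mN N0.
    by apply: le_lt_trans Boo; apply: le_measure; rewrite ?inE//; exact: subIsetl.
  by apply: ny; apply: full; exact: pi_simple.
by move=> y /= /not_implyP[].
Qed.

Lemma full_of_flux_in pi B : measurable B -> pi B < +oo ->
  flux matching pi setT B = pi B ->
  forall y, B y -> support pi y -> load matching (pi, y) = 1.
Proof.
move=> mB Boo; rewrite flux_in// => fB y By y1.
have pB : \int[pi]_(y in B) cst 1 y = pi B by rewrite integral_cst// mul1e.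
have [] : ae_eq pi B (fun y => load matching (pi, y)) (cst 1).
  apply: ae_eq_le_integral => //.
  - by apply: measurable_funTS; exact: measurable_load_slice.
  - by move=> z _; exact: matching_load_le1.
  - by move=> z _; rewrite ltry.
  - by rewrite pB.
  - by rewrite pB fB.
move=> N [mN N0 BN]; apply: contrapT => ny.
have Ny : N y by apply: BN => /(_ By).
suff : 1 <= 0 :> \bar R by rewrite lee_fin ler10.
rewrite -y1 -N0; apply: le_measure; rewrite ?inE//; first exact: measurable_set1_rV.
by move=> _ ->.
Qed.

(** Matched sites go to their atom. An unmatched site is its own default value,
which keeps the allocation equivariant. *)
Definition allocate pi x : V := xget x [set y | matching (pi, x, y)].

Lemma allocate_matched pi x y : matching (pi, x, y) -> allocate pi x = y.
Proof.
move=> xy; apply: xget_unique => // z xz; exact: matching_functional xz xy.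
Qed.

Lemma allocate_unmatched pi x : unmatched pi x -> allocate pi x = x.
Proof. exact: xgetPN. Qed.

Lemma allocate_translate z pi x :
  allocate (translate z pi) (x + z)%R = (allocate pi x + z)%R.
Proof.
have [ux|/existsNP[y /contrapT xy]] := pselect (unmatched pi x).
  by rewrite !allocate_unmatched//; exact/unmatched_translate.
rewrite (allocate_matched xy); apply: allocate_matched.
exact/equivariant_matching.
Qed.

(** As [allocate] is given by a choice operator, preimages are computed from
masses of sections of the matching. *)
Lemma measurable_allocate :
  measurable_fun setT (fun q : conf * V => allocate q.1 q.2).
Proof.
move=> _ B mB; rewrite setTI.
pose S := matching `&` snd @^-1` B.
have mS : measurable S.
  apply: measurableI; first exact: measurable_matching.
  exact: measurable_preimage mB.
have mSx := @measurable_config_xsection R n _ (conf * V)%type fst measurable_fst _ mS.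
rewrite (_ : _ @^-1` B = ([set q | unmatched q.1 q.2] `&` snd @^-1` B) `|`
   (fun q : conf * V => q.1 (xsection S q)) @^-1` (~` [set 0])).
  apply: measurableU.
    by apply: measurableI;
      [exact: measurable_unmatched|exact: measurable_preimage mB].
  by apply: measurable_preimage mSx _; apply: measurableC; exact: emeasurable_set1.
apply/seteqP; split=> -[pi x] /=.
  have [ux|/existsNP[y /contrapT xy]] := pselect (unmatched pi x).
    by rewrite allocate_unmatched//; left.
  rewrite (allocate_matched xy) => By; right => S0.
  suff : 1 <= 0 :> \bar R by rewrite lee_fin ler10.
  rewrite -(matching_atom xy) -S0; apply: le_measure; rewrite ?inE.
  - exact: measurable_set1_rV.
  - exact: measurable_xsection.
  - by rewrite xsectionE => _ ->.
move=> [[ux Bx]|S0]; first by rewrite allocate_unmatched.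
have [y [xy By]] : exists y, S (pi, x, y).
  apply: contrapT => nS; apply: S0.
  rewrite xsectionE (_ : [set y | _] = set0) ?measure0//.
  by apply/seteqP; split=> // y Sy; apply: nS; exists y.
by rewrite (allocate_matched xy).
Qed.

Lemma allocate_balanced pi : lebesgue_rV (unmatched pi) = 0 ->
  (forall y, support pi y -> load matching (pi, y) = 1) ->
  (forall s, support pi s -> lebesgue_rV (allocate pi @^-1` [set s]) = 1) /\
  lebesgue_rV (allocate pi @^-1` (~` support pi)) = 0.
Proof.
move=> U0 full; have mU := measurable_unmatched_slice pi.
have ma : measurable_fun setT (allocate pi).
  by apply: (measurableT_comp measurable_allocate (g := fun x => (pi, x)));
    exact: measurable_fun_pair.
split=> [s s1|].
  pose M := [set x | matching (pi, x, s)].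
  have mM : measurable M by apply: measurable_slice; exact: measurable_matching.
  have ms : measurable (allocate pi @^-1` [set s]).
    by apply: measurable_preimage => //; exact: measurable_set1_rV.
  apply/eqP; rewrite eq_le; apply/andP; split.
    apply: (@le_trans _ _ (lebesgue_rV (M `|` unmatched pi))).
      apply: le_measure; rewrite ?inE//; first exact: measurableU.
      move=> x /= xs;
        have [ux|/existsNP[y /contrapT xy]] := pselect (unmatched pi x).
        by right.
      by left; rewrite /M/= -xs (allocate_matched xy).
    apply: (le_trans (measureU2 _ mM mU)).
    by rewrite [X in _ + X]U0 adde0 -(full s s1).
  rewrite -(full s s1); apply: le_measure; rewrite ?inE//.
  by move=> x; exact: allocate_matched.
apply/eqP; rewrite eq_le measure_ge0 andbT -U0.
have sub : allocate pi @^-1` (~` support pi) `<=` unmatched pi.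
  move=> x /= nx y xy; apply: nx; rewrite (allocate_matched xy).
  exact: matching_atom xy.
apply: le_measure; rewrite ?inE//.
apply: measurable_preimage => //; apply: measurableC.
apply: (@measurable_preimage _ _ _ _ (fun y : V => pi [set y]) [set 1]) => //.
apply: (measurableT_comp (@measurable_singleton_mass R n) (g := fun y : V => (pi, y))).
exact: measurable_fun_pair.
Qed.

End allocation.

(** * Almost sure balance *)

Section existence.
Variables (R : realType) (n : nat) (Lam : probability (configuration R n) R).
Local Notation V := 'rV[R]_n.
Local Notation conf := (configuration R n).
Local Notation matching := (@matching R n).
Implicit Types (pi : conf).
Hypothesis n_ge1 : (1 <= n)%N.
Hypothesis Lam_inv : translation_invariant Lam.
Hypothesis Lam_ergodic : ergodic Lam.
Hypothesis Lam_simple : simple_process Lam.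
Hypothesis Lam_intensity : unit_intensity Lam.

Let mM := @measurable_matching R n.

Lemma integral_cst1 : \int[Lam]_pi (cst 1 pi : \bar R) = 1.
Proof. by rewrite integral_cst// mul1e; exact: probability_setT. Qed.

Lemma mean_flux_in_full w :
  {ae Lam, forall pi, flux matching pi setT (cell w) = pi (cell w)} ->
  mean_flux Lam matching setT (@cell R n w) = 1.
Proof.
move=> full; rewrite -(lebesgue_cell R w) -Lam_intensity;
  last exact: measurable_cell.
apply: ge0_ae_eq_integral => //.
- by apply: measurable_flux => //; exact: measurable_cell.
- by apply: measurable_config_eval; exact: measurable_cell.
- by move=> pi _; exact: flux_ge0.
- by apply: filterS full => pi + _.
Qed.

Lemma full_of_mean_flux_in w : mean_flux Lam matching setT (@cell R n w) = 1 ->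
  {ae Lam, forall pi, flux matching pi setT (cell w) = pi (cell w)}.
Proof.
have mw := @measurable_cell R n w.
have piE : \int[Lam]_pi pi (@cell R n w) = 1 by rewrite Lam_intensity// lebesgue_cell.
move=> m1.
have : ae_eq Lam setT (fun pi => flux matching pi setT (cell w)) (fun pi => pi (cell w)).
  apply: ae_eq_le_integral => //.
  - exact: measurable_flux.
  - exact: measurable_config_eval.
  - by move=> pi _; exact: flux_ge0.
  - by move=> pi _; exact: flux_in_le.
  - by move=> pi _; exact: cell_bounded.
  - by rewrite piE ltry.
  - by rewrite piE -m1.
by apply: filterS => pi; exact.
Qed.

Lemma unmatched_null_of_mean_flux_out :
  (forall w, mean_flux Lam matching (@cell R n w) setT = 1) ->
  {ae Lam, forall pi, lebesgue_rV (unmatched pi) = 0}.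
Proof.
move=> m1.
have cellU (w : 'rV[int]_n) :
    {ae Lam, forall pi, lebesgue_rV (cell w `&` unmatched pi) = 0}.
  have mw := @measurable_cell R n w.
  have : ae_eq Lam setT (fun pi => flux matching pi (cell w) setT) (cst 1).
    apply: ae_eq_le_integral => //.
    - exact: measurable_flux.
    - by move=> pi _; exact: flux_ge0.
    - move=> pi _; rewrite flux_out// -(lebesgue_cell R w).
      apply: le_measure; rewrite ?inE//.
      by apply: measurableD => //; exact: measurable_unmatched_slice.
    - by move=> pi _; rewrite ltry.
    - by rewrite integral_cst1 ltry.
    - by rewrite integral_cst1 -(m1 w).
  apply: filterS => pi /(_ I); rewrite flux_out//= => D1.
  have DI : lebesgue_rV (cell w) = lebesgue_rV (cell w `\` unmatched pi) +
      lebesgue_rV (cell w `&` unmatched pi).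
    by apply: measureDI => //; exact: measurable_unmatched_slice.
  move: DI; rewrite lebesgue_cell D1; case: (lebesgue_rV (_ `&` _)) => [r||]//.
  by rewrite -EFinD => -[r0]; congr (_%:E); lra.
have : {ae Lam, forall pi, forall j, lebesgue_rV (nat_cell id j `&` unmatched pi) = 0}.
  apply/ae_foralln => j; rewrite /nat_cell; case: pickle_inv => [w|];
    first exact: cellU.
  by apply: aeW => pi; rewrite set0I measure0.
apply: filterS => pi h; have mU := measurable_unmatched_slice pi.
rewrite -[unmatched pi]setTI -(@bigcup_nat_cell R n id); last by move=> v; exists v.
rewrite setI_bigcupl measure_semi_bigcup.
- by rewrite eseries0// => j _ _; exact: h.
- by move=> j; apply: measurableI => //; exact: measurable_nat_cell.
- by apply: trivIset_setIr; apply: trivIset_nat_cell.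
- by apply: bigcup_measurable => j _; apply: measurableI => //;
  exact: measurable_nat_cell.
Qed.

Lemma mean_flux_out_full w :
  {ae Lam, forall pi, lebesgue_rV (unmatched pi) = 0} ->
  mean_flux Lam matching (@cell R n w) setT = 1.
Proof.
move=> U0; have mw := @measurable_cell R n w.
transitivity (\int[Lam]_pi (cst 1 pi : \bar R)).
  apply: ge0_ae_eq_integral => //.
  - exact: measurable_flux.
  - by move=> pi _; exact: flux_ge0.
  apply: filterS U0 => pi U0 _; have mU := measurable_unmatched_slice pi.
  have I0 : lebesgue_rV (cell w `&` unmatched pi) = 0.
    apply/eqP; rewrite eq_le measure_ge0 andbT -[leRHS]U0.
    by apply: le_measure; rewrite ?inE//; exact: measurableI.
  have DI : lebesgue_rV (cell w) = lebesgue_rV (cell w `\` unmatched pi) +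
    lebesgue_rV (cell w `&` unmatched pi) by exact: measureDI.
  by rewrite flux_out//= -(lebesgue_cell R w) DI I0 adde0.
exact: integral_cst1.
Qed.

(** The configurations whose unmatched sites have positive volume. *)
Definition wasteful : set conf := [set pi | 0 < lebesgue_rV (unmatched pi)].

Lemma measurable_wasteful : measurable wasteful.
Proof.
have h := measurable_fun_xsection (@lebesgue_rV R n) (@measurable_unmatched R n).
rewrite (_ : wasteful = (@lebesgue_rV R n \o xsection [set q | unmatched q.1 q.2]) @^-1` `]0, +oo[).
  by apply: measurable_preimage h _; exact: emeasurable_itv.
apply/seteqP; split=> pi; rewrite /wasteful/= xsectionE in_itv/=.
- by rewrite andbT.
- by rewrite andbT.
Qed.

Lemma wasteful_translate z : translate z @^-1` wasteful = wasteful.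
Proof.
have E pi : lebesgue_rV (unmatched (translate z pi)) = lebesgue_rV (unmatched pi).
  rewrite -(lebesgue_rV_shift z); last exact: measurable_unmatched_slice.
  by congr lebesgue_rV; apply/seteqP; split=> x /= /unmatched_translate.
by apply/seteqP; split=> pi; rewrite /wasteful/= E.
Qed.

Lemma wasteful_full pi : wasteful pi ->
  forall y, support pi y -> load matching (pi, y) = 1.
Proof.
move=> wpi y y1; apply/eqP; rewrite eq_le matching_load_le1/= leNgt;
  apply/negP => ly.
have M := matching_exhaustive n_ge1 y1 ly.
move: wpi; rewrite /wasteful/= (_ : unmatched pi = set0) ?measure0 ?ltxx//.
by apply/seteqP; split=> // x; have [y' xy'] := M x => /(_ y').
Qed.

(** If the invariant event [wasteful] had probability one, all atoms would have
load one, so the matched sites would have full mean volume in every cell. *)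
Lemma unmatched_null : {ae Lam, forall pi, lebesgue_rV (unmatched pi) = 0}.
Proof.
have [W0|W1] := Lam_ergodic measurable_wasteful wasteful_translate.
  exists wasteful; split=> //; first exact: measurable_wasteful.
  move=> pi /= /eqP U0; rewrite /wasteful/= lt_neqAle measure_ge0 andbT eq_sym.
  exact: U0.
have aeW : {ae Lam, forall pi, wasteful pi}.
  exists (~` wasteful); split=> //; first by apply: measurableC;
    exact: measurable_wasteful.
  by rewrite probability_setC ?W1 ?subee//; exact: measurable_wasteful.
apply: unmatched_null_of_mean_flux_out => w.
rewrite mass_transport//; last exact: equivariant_matching.
apply: mean_flux_in_full; apply: filterS2 Lam_simple aeW => pi simple_pi wpi.
apply: flux_in_full => //; [exact: measurable_cell|exact: cell_bounded|].
exact: wasteful_full.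
Qed.

Lemma matching_full : {ae Lam, forall pi, forall y,
  support pi y -> load matching (pi, y) = 1}.
Proof.
have : {ae Lam, forall pi, forall j,
    flux matching pi setT (nat_cell id j) = pi (nat_cell id j)}.
  apply/ae_foralln => j; rewrite /nat_cell; case: pickle_inv => [w|].
    apply: full_of_mean_flux_in; rewrite -mass_transport//; last first.
      exact: equivariant_matching.
    by apply: mean_flux_out_full; exact: unmatched_null.
  by apply: aeW => pi; rewrite flux_in// integral_set0 measure0.
apply: filterS => pi h y y1.
have [j _ yj] : (\bigcup_j @nat_cell R n id j) y.
  by rewrite bigcup_nat_cell// => v; exists v.
apply: full_of_flux_in (h j) y yj y1; first exact: measurable_nat_cell.
rewrite /nat_cell; case: pickle_inv => [w|]; first exact: cell_bounded.
by rewrite measure0.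
Qed.

(** The allocation rule is defined on all configurations. *)
Definition greedy_allocation_rule : allocation_rule Lam.
Proof.
refine (@AllocationRule R n Lam setT (@allocate R n) measurableT _ _ _ _) => //.
- by apply: aeW.
- by rewrite setXTT; exact: measurable_allocate.
- by move=> z pi x y _ <-; exact: allocate_translate.
Defined.

Lemma greedy_allocation_balanced : balanced greedy_allocation_rule.
Proof.
by apply: filterS2 unmatched_null matching_full => pi; exact: allocate_balanced.
Qed.

End existence.

Theorem theorem21 (R : realType) (d : nat) (d_ge1 : (1 <= d)%N)
    (disp : measure_display) (Omega : measurableType disp)
    (P : probability Omega R) (Pi : {RV P >-> configuration R d}) :
  translation_invariant (distribution P Pi) ->
  ergodic (distribution P Pi) ->
  simple_process (distribution P Pi) ->
  unit_intensity (distribution P Pi) ->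
  exists Psi : allocation_rule (distribution P Pi), balanced Psi.
Proof.
move=> inv erg simple intensity.
exists (greedy_allocation_rule (distribution P Pi)).
exact: greedy_allocation_balanced.
Qed.
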